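(* Let $0<p\le 1$ and $p<q\le 2$. Assume that $\sigma_j=j^{-\lambda}$, $j\in\mathbb{N}$, for some $\lambda>0$. Then there exist constants $C,D\in(0,\infty)$, and a constant $K\in(0,\infty)$ depending only on $p$ and $q$, such that, for all $m\in\mathbb{N}$ and all integers $1\le n<m$ with $$n\ge D\log(\mathrm{e}m/n),$$ we have $$ \mathrm{rad}_q(\mathcal{E}_{p,\sigma}^m,\ker G_{n,m})\le K\Big(\frac{\log(\mathrm{e}m/n)}{n}\Big)^{\lambda+1/p-1/q} $$ with probability at least $1-2\exp(-Cn)$.
   Context: For $0<p<\infty$ and $x\in\mathbb{R}^m$, $\|x\|_p=(|x_1|^p+\cdots+|x_m|^p)^{1/p}$, and $\|x\|_\infty=\max_{1\le j\le m}|x_j|$. For semiaxes $\sigma_1\ge\cdots\ge\sigma_m>0$, the $\ell_p$-ellipsoid is $\mathcal{E}_{p,\sigma}^m=\{x\in\mathbb{R}^m:\|(x_j/\sigma_j)_{j=1}^m\|_p\le 1\}$. $G_{n,m}\in\mathbb{R}^{n\times m}$ is a random matrix with i.i.d. standard Gaussian entries. For a linear subspace $E\subset\mathbb{R}^m$ and $0<q\le\infty$, $\mathrm{rad}_q(\mathcal{E}_{p,\sigma}^m,E):=\sup_{x\in\mathcal{E}_{p,\sigma}^m\cap E}\|x\|_q$.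
   Formalization: The constant K may depend on λ as well as on p and q; a K depending only on p and q is impossible, since m=n+1 with n→∞ forces K ≥ c_{p,q}(λp+1)^{1/p}, unbounded in λ. *)

(* Defs.v *)
From HB Require Import structures.
From mathcomp Require Import all_boot all_order all_algebra.
From mathcomp Require Import all_classical all_reals all_analysis.
Set Implicit Arguments.
Unset Strict Implicit.
Unset Printing Implicit Defensive.
Import Order.TTheory GRing.Theory Num.Theory.
Import numFieldNormedType.Exports.
Local Open Scope classical_set_scope.
Local Open Scope ring_scope.

(* For 0 < p < +oo; [0 `^ p = 0] since p != 0. *)
Definition lpnorm (R : realType) (p : R) (m : nat) (x : 'cV[R]_m) : R :=
  (\sum_(j < m) `|x j 0| `^ p) `^ p^-1.

(* Semiaxes are indexed from 1, so the coordinate [j : 'I_m] has semiaxis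
   [sigma j.+1]; the value [sigma 0] is never used. *)
Definition ellipsoid (R : realType) (p : R) (sigma : nat -> R) (m : nat) :
    set 'cV[R]_m :=
  [set x | lpnorm p (\col_(j < m) (x j 0 / sigma j.+1)) <= 1].
Arguments ellipsoid {R} p sigma m _ : rename.

(* MathComp's [kermx] is the kernel of left multiplication by row vectors;
   here a matrix acts on column vectors. *)
Definition rkernel (R : realType) (n m : nat) (M : 'M[R]_(n, m)) :
    set 'cV[R]_m :=
  [set x | M *m x = 0].

(* The supremum is taken in [\bar R], so that it is a genuine supremum without
   any boundedness side condition. *)
Definition lp_radius (R : realType) (q : R) (m : nat) (A E : set 'cV[R]_m) : \bar R :=
  ereal_sup [set (lpnorm q x)%:E | x in A `&` E].

Definition mutually_independent (R : realType) (d : measure_display)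
    (T : measurableType d) (P : probability T R) (I : finType)
    (X : I -> {RV P >-> R}) : Prop :=
  forall (J : {set I}) (B : I -> set R),
    (forall i, i \in J -> measurable (B i)) ->
    P (\bigcap_(i in [set` J]) (X i @^-1` B i)) =
    (\prod_(i in J) P (X i @^-1` B i))%E.

Definition standard_gaussian (R : realType) (d : measure_display)
    (T : measurableType d) (P : probability T R) (X : {RV P >-> R}) : Prop :=
  forall B : set R, measurable B -> distribution P X B = normal_prob 0 1 B.

Definition gaussian_matrix (R : realType) (d : measure_display)
    (T : measurableType d) (P : probability T R) (n m : nat)
    (G : 'I_n -> 'I_m -> {RV P >-> R}) : Prop :=
  mutually_independent (fun ij : 'I_n * 'I_m => G ij.1 ij.2) /\
  forall i j, standard_gaussian (G i j).

Definition matrix_at (R : realType) (d : measure_display)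
    (T : measurableType d) (P : probability T R) (n m : nat)
    (G : 'I_n -> 'I_m -> {RV P >-> R}) (w : T) : 'M[R]_(n, m) :=
  \matrix_(i < n, j < m) G i j w.

(* "The event E holds with probability at least a".  The value of [P] on a
   set not known to be measurable carries no information, hence the measurable
   subset; for measurable E this is [a <= P E], see [with_prob_geE]. *)
Definition with_prob_ge (R : realType) (d : measure_display)
    (T : measurableType d) (P : probability T R) (a : R) (E : set T) : Prop :=
  exists A : set T, [/\ measurable A, A `<=` E & (a%:E <= P A)%E].

Lemma with_prob_geE (R : realType) (d : measure_display)
    (T : measurableType d) (P : probability T R) (a : R) (E : set T) :
  measurable E -> with_prob_ge P a E <-> (a%:E <= P E)%E.
Proof.
move=> mE; split=> [[A [mA AE aA]]|aE]; last by exists E; split.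
by rewrite (le_trans aA)// le_measure ?inE.
Qed.

(* Main.v *)
Require Import Defs.
From HB Require Import structures.
From mathcomp Require Import all_boot all_order all_algebra.
From mathcomp Require Import all_classical all_reals all_analysis.
From mathcomp Require Import measurable_realfun.
From mathcomp Require Import ring lra.
Set Implicit Arguments.
Unset Strict Implicit.
Unset Printing Implicit Defensive.
Import Order.TTheory GRing.Theory Num.Theory.
Import numFieldNormedType.Exports.
Import HBNNSimple.
Local Open Scope classical_set_scope.
Local Open Scope ring_scope.

(** A Gaussian matrix $G$ with $n$ rows is, with high probability, bounded from
    above and from below on all $k$-sparse vectors $u$, in the sense that
    $a n\|u\|_2 \le \|Gu\|_1 \le b n\|u\|_2$, as soon as
    $k\log(\mathrm em/n)$ is a small multiple of $n$
    ([gaussian_sparse_bounds]).  Put $k = 2s$ with $s$ a small multiple of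
    $n/\log(\mathrm em/n)$.  Let $x$ be a kernel vector in the ellipsoid and
    let $T$ consist of the first $s$ coordinates and of the $s$ largest ones
    among the others.  Beyond the first $s$ coordinates the semiaxes are at most
    $s^{-\lambda}$, so that outside $T$ the entries of $x$ are at most
    $e = s^{-\lambda-1/p}$ and their $p$-th powers add up to at most $s e^p$
    ([ellipsoid_flat_tail]).  Cutting the tail
    into blocks of decreasing magnitude, the upper bound gives
    $\|Gx_{T^c}\|_1 \le 2bn\sqrt s e$ ([l1norm_mulmx_le_blocks]); since
    $Gx_T = -Gx_{T^c}$, the lower bound yields $\|x_T\|_2 \le (2b/a)\sqrt s e$.
    Hence both parts of $x$ have $q$-th power sums of order $s e^q$
    ([kernel_powR_sum_le]), so that $\|x\|_q$ is of order
    $s^{1/q} e = s^{-(\lambda+1/p-1/q)}$.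

    Measuring $Gu$ in $\ell_1$ instead of $\ell_2$ keeps the probabilistic part
    elementary.  Both tails of $\|Gu\|_1$ are controlled by products over the
    rows of polynomials in $e^{\pm(Gu)_i}$.  Such a product expands into
    exponentials of linear forms of the matrix, whose expectations are explicit
    ([gaussian_matrix_expR]): for the upper tail
    $e^{|x|} \le e^x + e^{-x}$ is used ([gaussian_l1norm_upper]), for the lower
    one a fixed exponential polynomial above $e^{-8|x|}$ of Gaussian mean less
    than 1 ([gaussian_l1norm_lower]).  A union bound over lattice points close
    to sparse vectors, counted in [card_net_le], and the extension from lattice
    points to all sparse vectors ([sparse_bounds_of_net]) conclude. *)

(** * Integrals of products of independent variables *)

Lemma ge0_integral_simple_density (R : realType) (d d' : measure_display)
    (T : measurableType d) (T' : measurableType d')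
    (mu : {measure set T -> \bar R}) (nu : {measure set T' -> \bar R})
    (F : T -> R) (X : T -> T') (c : R) :
  measurable_fun setT F -> (forall w, 0 <= F w) -> measurable_fun setT X ->
  0 <= c ->
  (forall B : set T', measurable B ->
    (\int[mu]_w (F w * \1_B (X w))%:E = c%:E * nu B)%E) ->
  forall f : {nnsfun T' >-> R},
    (\int[mu]_w (F w * f (X w))%:E = c%:E * \int[nu]_x (f x)%:E)%E.
Proof.
move=> mF F0 mX c0 H f.
set s := finmap.enum_fset (fset_set (range f)).
have s0 (i : 'I_(size s)) : 0 <= s`_i.
  have : s`_i \in s by exact: mem_nth.
  rewrite /s in_fset_set; last exact: fimfunP.
  by rewrite inE => -[x _ <-]; exact: fun_ge0.
have mB (i : 'I_(size s)) : measurable (f @^-1` [set s`_i]).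
  by rewrite -[X in measurable X]setTI; apply: measurable_funP.
have fE x : f x = \sum_(i < size s) s`_i * \1_(f @^-1` [set s`_i]) x.
  exact: fimfunEord.
have mI i : measurable_fun setT (fun x : T' => (\1_(f @^-1` [set s`_i]) x : R)).
  apply: measurable_realfun.measurable_indic.
  by rewrite -[X in measurable X]setTI; apply: measurable_funP.
transitivity (\sum_(i < size s) (s`_i)%:E * (c%:E * nu (f @^-1` [set s`_i])))%E.
  under eq_integral => w _.
    rewrite fE mulr_sumr -sumEFin.
    over.
  rewrite ge0_integral_sum//=; last 2 first.
  - move=> i; apply/measurable_EFinP; apply: measurable_funM => //.
    apply: measurable_funM => //.
    exact: measurableT_comp (mI i) mX.
  - by move=> i w _; rewrite lee_fin mulr_ge0// mulr_ge0.
  apply: eq_bigr => i _.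
  rewrite -H//.
  rewrite -ge0_integralZl//=; last 3 first.
  - apply/measurable_EFinP; apply: measurable_funM => //.
    exact: measurableT_comp (mI i) mX.
  - by move=> w _; rewrite lee_fin mulr_ge0.
  - by rewrite lee_fin.
  by apply: eq_integral => w _; rewrite -EFinM mulrCA.
rewrite (_ : \int[nu]_x (f x)%:E =
    \sum_(i < size s) (s`_i)%:E * nu (f @^-1` [set s`_i]))%E.
  rewrite ge0_sume_distrr; last first.
    by move=> i _; rewrite mule_ge0 ?lee_fin.
  by apply: eq_bigr => i _; rewrite muleCA.
under eq_integral => w _.
  rewrite fE -sumEFin.
  over.
rewrite ge0_integral_sum//=; last 2 first.
- by move=> i; apply/measurable_EFinP; apply: measurable_funM.
- by move=> i w _; rewrite lee_fin mulr_ge0.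
apply: eq_bigr => i _.
under eq_integral do rewrite EFinM.
rewrite ge0_integralZl//=; last 2 first.
- by apply/measurable_EFinP.
- by rewrite lee_fin.
by rewrite integral_indic// setIT.
Qed.

(** A change of variables: the hypothesis says that the measure of density [F]
    has image [c * nu] under [X]; simple functions and monotone convergence
    carry this from sets to functions.  It serves both to integrate against a
    Gaussian density and to separate one variable from an independent
    product. *)
Lemma ge0_integral_density (R : realType) (d d' : measure_display)
    (T : measurableType d) (T' : measurableType d')
    (mu : {measure set T -> \bar R}) (nu : {measure set T' -> \bar R})
    (F : T -> R) (X : T -> T') (c : R) :
  measurable_fun setT F -> (forall w, 0 <= F w) -> measurable_fun setT X ->
  0 <= c ->
  (forall B : set T', measurable B ->
    (\int[mu]_w (F w * \1_B (X w))%:E = c%:E * nu B)%E) ->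
  forall f : T' -> R, measurable_fun setT f -> (forall x, 0 <= f x) ->
    (\int[mu]_w (F w * f (X w))%:E = c%:E * \int[nu]_x (f x)%:E)%E.
Proof.
move=> mF F0 mX c0 H f mf f0.
have mf' : measurable_fun setT (EFin \o f) by exact/measurable_EFinP.
pose g := nnsfun_approx measurableT mf'.
have g0 n x : 0 <= g n x by exact: fun_ge0.
have nd x : {homo (fun n => g n x) : a b / (a <= b)%N >-> a <= b}.
  by move=> a b ab; exact/lefP/nd_nnsfun_approx.
have cg x : (g n x)%:E @[n --> \oo] --> (f x)%:E.
  by apply: (@cvg_nnsfun_approx _ _ _ _ measurableT _ mf') => // y _; rewrite lee_fin.
have mg n : measurable_fun setT (g n) by exact: measurable_funP.
transitivity (\int[mu]_w limn (fun n => (F w * g n (X w))%:E))%E.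
  apply: eq_integral => w _; apply/esym/cvg_lim => //.
  under eq_fun do rewrite EFinM.
  by rewrite EFinM; apply: cvgeZl => //; exact: cg.
rewrite monotone_convergence//; last 3 first.
- move=> n; apply/measurable_EFinP; apply: measurable_funM => //.
  exact: measurableT_comp (mg n) mX.
- by move=> n w _; rewrite lee_fin mulr_ge0.
- by move=> w _ a b ab; rewrite lee_fin ler_wpM2l//; exact: nd.
transitivity (limn (fun n => c%:E * \int[nu]_x (g n x)%:E))%E.
  by congr (limn _); apply/funext => n; exact: ge0_integral_simple_density.
apply/cvg_lim => //; apply: cvgeZl => //.
rewrite (_ : (\int[nu]_x (f x)%:E = \int[nu]_x (limn (fun n => (g n x)%:E)))%E).
  apply: cvg_monotone_convergence => //.
  - by move=> n; exact/measurable_EFinP.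
  - by move=> n w _; rewrite lee_fin.
  - by move=> w _ a b ab; rewrite lee_fin; exact: nd.
by apply: eq_integral => x _; apply/esym/cvg_lim => //; exact: cg.
Qed.

(** Replacing the functions [g i] one at a time by indicators reduces the
    product formula to the product rule for events; the list [s] records the
    indices at which [g i] is still arbitrary. *)
Lemma indep_integral_prod_seq (R : realType) (d : measure_display)
    (T : measurableType d) (P : probability T R) (I : finType)
    (X : I -> {RV P >-> R}) (s : seq I) (g : I -> R -> R) (e : I -> R) :
  mutually_independent X ->
  (forall i, measurable_fun setT (g i)) -> (forall i x, 0 <= g i x) ->
  (forall i, \int[P]_w (g i (X i w))%:E = (e i)%:E)%E ->
  (forall i, i \notin s -> exists2 B : set R, measurable B & g i = \1_B) ->
  (\int[P]_w (\prod_i g i (X i w))%:E = (\prod_i e i)%:E)%E.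
Proof.
move=> indX; elim: s g e => [|k s IHs] g e mg g0 ge gs.
  have /choice[B HB] : forall i, exists B : set R, measurable B /\ g i = \1_B.
    by move=> i; have [//|B mB gB] := gs i; exists B.
  have mB i : measurable (X i @^-1` B i).
    by rewrite -[X in measurable X]setTI; apply: measurable_funP => //; case: (HB i).
  have eP i : ((e i)%:E = P (X i @^-1` B i))%E.
    rewrite -ge -[in RHS](setIT (X i @^-1` B i)) -integral_indic//.
    by apply: eq_integral => w _; case: (HB i) => _ ->.
  rewrite -prodEFin.
  under [RHS]eq_bigr do rewrite eP.
  have /= := indX [set: I]%SET B (fun i _ => (HB i).1).
  rewrite [X in _ = X -> _](eq_bigl xpredT); last by move=> i; rewrite inE.
  move=> <-.
  set C := \bigcap_(i in _) _.
  have mC : measurable C.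
    by apply: fin_bigcap_measurable => //; exact: finite_finset.
  rewrite -[in RHS](setIT C) -integral_indic//.
  apply: eq_integral => w _; congr EFin.
  rewrite indicE.
  have [wC|wC] := boolP (w \in C).
    rewrite big1// => i _; rewrite (HB i).2 indicE mem_set//.
    by move: wC; rewrite inE => /(_ i); apply; rewrite /= inE.
  have [i wi] : exists i, ~ B i (X i w).
    apply/existsNP => H; move/negP: wC; apply; rewrite inE => i _.
    exact: H.
  by rewrite (bigD1 i)//= (HB i).2 indicE memNset// mul0r.
have mF (A : pred I) : measurable_fun setT (fun w => \prod_(i | A i) g i (X i w)).
  under eq_fun do rewrite -big_filter.
  by apply: measurable_prod => i _; apply: measurableT_comp (mg i) _.
have e0 i : 0 <= e i.
  by rewrite -lee_fin -ge; apply: integral_ge0 => w _; rewrite lee_fin.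
rewrite (bigD1 k)//= mulrC EFinM -ge.
under eq_integral => w _ do rewrite (bigD1 k)//= mulrC.
rewrite (@ge0_integral_density _ _ _ _ _ P (distribution P (X k)) _ _
  (\prod_(i | i != k) e i))//; last 3 first.
- by move=> w; apply: prodr_ge0.
- by apply: prodr_ge0 => i _.
- move=> B mB.
  pose g' i := if i == k then \1_B : R -> R else g i.
  pose e' i := if i == k then fine (P (X k @^-1` B)) else e i.
  have mXB : measurable (X k @^-1` B).
    by rewrite -[X in measurable X]setTI; apply: measurable_funP.
  have := IHs g' e'.
  have ek : e' k = fine (P (X k @^-1` B)) by rewrite /e' eqxx.
  rewrite (bigD1 k)//= ek mulrC EFinM fineK; last first.
    by apply: fin_num_measure.
  rewrite (eq_bigr e); last by move=> i /negbTE ik; rewrite /e' ik.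
  move=> <- //.
  + apply: eq_integral => w _; rewrite [in RHS](bigD1 k)//= [in RHS]mulrC.
    have gk : g' k = \1_B by rewrite /g' eqxx.
    rewrite gk; congr (_ * _)%:E.
    by apply: eq_bigr => i /negbTE ik; rewrite /g' ik.
  + by move=> i; rewrite /g'; case: eqP => // _; exact: measurable_indic.
  + by move=> i x; rewrite /g'; case: eqP => // _; rewrite indicE.
  + move=> i; rewrite /g' /e'; case: eqP => // ->.
    rewrite fineK ?fin_num_measure// -[in RHS](setIT (X k @^-1` B)).
    by rewrite -integral_indic.
  + move=> i si; rewrite /g'; case: eqP => [_|/eqP ik]; first by exists B.
    by apply: gs; rewrite inE negb_or ik.
congr (_ * _)%E.
have mgk : measurable_fun [set: R] (EFin \o g k) by exact/measurable_EFinP.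
by rewrite -(ge0_integral_distribution (X k) mgk)// => x; rewrite /= lee_fin.
Qed.

Lemma indep_integral_prod (R : realType) (d : measure_display)
    (T : measurableType d) (P : probability T R) (I : finType)
    (X : I -> {RV P >-> R}) (g : I -> R -> R) (e : I -> R) :
  mutually_independent X ->
  (forall i, measurable_fun setT (g i)) -> (forall i x, 0 <= g i x) ->
  (forall i, \int[P]_w (g i (X i w))%:E = (e i)%:E)%E ->
  (\int[P]_w (\prod_i g i (X i w))%:E = (\prod_i e i)%:E)%E.
Proof.
move=> indX mg g0 ge.
apply: (@indep_integral_prod_seq _ _ _ _ _ _ (enum I)) => // i.
by rewrite mem_enum inE.
Qed.

(** Completing the square turns the integrand into a multiple of the density of
    mean [a]. *)
Lemma normal_prob_expR (R : realType) (a : R) :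
  (\int[normal_prob 0 1]_x (expR (a * x))%:E = (expR (a ^+ 2 / 2))%:E)%E.
Proof.
have mexp : measurable_fun [set: R] (fun x : R => expR (a * x)).
  by apply: measurableT_comp => //; exact: measurable_funM.
rewrite -[LHS]mul1e.
rewrite -(@ge0_integral_density R _ _ (measurableTypeR R) _ lebesgue_measure
  (normal_prob 0 1) (normal_pdf 0 1) idfun)//; last 4 first.
- exact: measurable_normal_pdf.
- by move=> x; exact: normal_pdf_ge0.
- exact: measurable_id.
- move=> B mB.
  transitivity (\int[lebesgue_measure]_(x in B) (normal_pdf 0 1 x)%:E)%E; last first.
    by rewrite mul1e.
  rewrite [in RHS]integral_mkcond/=.
  apply: eq_integral => x _; rewrite /patch/= indicE.
  by case: ifPn => _; rewrite ?mulr1 ?mulr0.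
transitivity (\int[lebesgue_measure]_x
    ((expR (a ^+ 2 / 2))%:E * (normal_pdf a 1 x)%:E))%E.
  apply: eq_integral => x _; rewrite -EFinM; congr EFin.
  have H : expR (a ^+ 2 / 2) * normal_fun a 1 x = normal_fun 0 1 x * expR (a * x).
    by rewrite /normal_fun -!expRD; congr expR; field.
  by rewrite !normal_pdfE// mulrCA H mulrA.
rewrite ge0_integralZl//=.
- by rewrite integral_normal_pdf mule1.
- by apply/measurable_EFinP; exact: measurable_normal_pdf.
- by move=> x _; rewrite lee_fin normal_pdf_ge0.
Qed.

(** The later estimates see the matrix only through these exponential
    moments. *)
Lemma gaussian_matrix_expR (R : realType) (d : measure_display)
    (T : measurableType d) (P : probability T R) (n m : nat)
    (G : 'I_n -> 'I_m -> {RV P >-> R}) (a : 'I_n -> 'I_m -> R) :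
  gaussian_matrix G ->
  (\int[P]_w (expR (\sum_i \sum_j a i j * G i j w))%:E =
   (expR (\sum_i \sum_j a i j ^+ 2 / 2))%:E)%E.
Proof.
move=> [indG gaussG].
transitivity (\int[P]_w
    (\prod_(ij : 'I_n * 'I_m) expR (a ij.1 ij.2 * G ij.1 ij.2 w))%:E)%E.
  by apply: eq_integral => w _; rewrite pair_big/= expR_sum.
rewrite (@indep_integral_prod _ _ _ _ _ _
  (fun ij : 'I_n * 'I_m => fun x => expR (a ij.1 ij.2 * x))
  (fun ij : 'I_n * 'I_m => expR (a ij.1 ij.2 ^+ 2 / 2)))//.
- by rewrite pair_big/= expR_sum.
- by move=> ij; apply: measurableT_comp => //; exact: measurable_funM.
- move=> ij; rewrite -normal_prob_expR.
  have mG : measurable_fun setT (G ij.1 ij.2 : T -> R) by [].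
  have mexp : measurable_fun [set: R] (fun x : R => expR (a ij.1 ij.2 * x)).
    by apply: measurableT_comp => //; exact: measurable_funM.
  have := @ge0_integral_density R _ _ T (measurableTypeR R) P (normal_prob 0 1)
    (cst 1) (G ij.1 ij.2) 1 (measurable_cst _) (fun=> ler01) mG ler01 _ _ mexp
    (fun=> expR_ge0 _).
  rewrite mul1e => <-.
  + by apply: eq_integral => w _; rewrite mul1r.
  + move=> B mB.
    transitivity (P (G ij.1 ij.2 @^-1` B)); last by rewrite mul1e; exact: gaussG.
    have mGB : measurable (G ij.1 ij.2 @^-1` B).
      by rewrite -[X in measurable X]setTI; apply: mG.
    rewrite -[in RHS](setIT (_ @^-1` B)) -integral_indic//.
    by apply: eq_integral => w _; rewrite mul1r.
Qed.

(** * Tail bounds for Gaussian matrices *)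

Definition sqnorm (R : realType) (m : nat) (x : 'cV[R]_m) : R :=
  \sum_j x j 0 ^+ 2.

Definition l1norm (R : realType) (m : nat) (x : 'cV[R]_m) : R :=
  \sum_j `|x j 0|.

(** The product over the rows expands into exponentials of linear forms of the
    entries; hence the product formula for the rows follows from that for the
    entries. *)
Lemma gaussian_rows_expR_sum (R : realType) (d : measure_display)
    (T : measurableType d) (P : probability T R) (n m : nat)
    (G : 'I_n -> 'I_m -> {RV P >-> R}) (K : finType) (c theta : K -> R)
    (u : 'cV[R]_m) :
  gaussian_matrix G ->
  (\int[P]_w (\prod_i \sum_k c k * expR (theta k * (matrix_at G w *m u) i 0))%:E
   = ((\sum_k c k * expR (theta k ^+ 2 * sqnorm u / 2)) ^+ n)%:E)%E.
Proof.
move=> GG.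
pose a (f : {ffun 'I_n -> K}) i j := theta (f i) * u j 0.
have aE (f : {ffun 'I_n -> K}) w : \prod_i expR (theta (f i) * (matrix_at G w *m u) i 0) =
    expR (\sum_i \sum_j a f i j * G i j w).
  rewrite -expR_sum; congr expR; apply: eq_bigr => i _.
  rewrite !mxE mulr_sumr; apply: eq_bigr => j _.
  by rewrite !mxE /a mulrCA mulrC.
have mE (f : {ffun 'I_n -> K}) : measurable_fun setT (fun w => (expR (\sum_i \sum_j a f i j * G i j w))%:E).
  apply/measurable_EFinP; apply: measurableT_comp => //.
  by apply: measurable_sum => i; apply: measurable_sum => j; apply: measurable_funM.
have iE (f : {ffun 'I_n -> K}) : P.-integrable setT (fun w => (expR (\sum_i \sum_j a f i j * G i j w))%:E).
  apply/integrableP; split => //.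
  under eq_integral do rewrite gee0_abs ?lee_fin ?expR_ge0//.
  by rewrite gaussian_matrix_expR// ltry.
transitivity (\int[P]_w \sum_(f : {ffun 'I_n -> K})
    (\prod_i c (f i))%:E * (expR (\sum_i \sum_j a f i j * G i j w))%:E)%E.
  apply: eq_integral => w _; rewrite bigA_distr_bigA/= -sumEFin.
  by apply: eq_bigr => f _; rewrite big_split/= aE EFinM.
rewrite integral_sum//; last by move=> f; exact: integrableZl.
rewrite -[X in (_ ^+ X)%:E]card_ord -prodr_const bigA_distr_bigA/= -sumEFin.
apply: eq_bigr => f _; rewrite integralZl// gaussian_matrix_expR// -EFinM.
rewrite big_split/=; congr (_ * _)%:E; rewrite -expR_sum; congr expR.
apply: eq_bigr => i _; rewrite /sqnorm mulr_sumr mulr_suml.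
by apply: eq_bigr => j _; rewrite /a exprMn.
Qed.

Lemma measurable_matrix_mulmx (R : realType) (d : measure_display)
    (T : measurableType d) (P : probability T R) (n m : nat)
    (G : 'I_n -> 'I_m -> {RV P >-> R}) (u : 'cV[R]_m) i :
  measurable_fun setT (fun w => (matrix_at G w *m u) i 0).
Proof.
rewrite (_ : (fun _ => _) = fun w => \sum_j G i j w * u j 0).
  by apply: measurable_sum => j; apply: measurable_funM.
by apply/funext => w; rewrite !mxE; apply: eq_bigr => j _; rewrite mxE.
Qed.

Lemma measurable_l1norm_mulmx (R : realType) (d : measure_display)
    (T : measurableType d) (P : probability T R) (n m : nat)
    (G : 'I_n -> 'I_m -> {RV P >-> R}) (u : 'cV[R]_m) :
  measurable_fun setT (fun w => l1norm (matrix_at G w *m u)).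
Proof.
apply: measurable_sum => i; apply: measurableT_comp => //.
exact: measurable_matrix_mulmx.
Qed.

Lemma measurable_l1norm_le (R : realType) (d : measure_display)
    (T : measurableType d) (P : probability T R) (n m : nat)
    (G : 'I_n -> 'I_m -> {RV P >-> R}) (u : 'cV[R]_m) (b : R) :
  measurable [set w | l1norm (matrix_at G w *m u) <= b].
Proof.
rewrite -[X in measurable X]setTI.
by apply: measurable_fun_ler => //; exact: measurable_l1norm_mulmx.
Qed.

Lemma measurable_l1norm_ge (R : realType) (d : measure_display)
    (T : measurableType d) (P : probability T R) (n m : nat)
    (G : 'I_n -> 'I_m -> {RV P >-> R}) (u : 'cV[R]_m) (b : R) :
  measurable [set w | b <= l1norm (matrix_at G w *m u)].
Proof.
rewrite -[X in measurable X]setTI.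
by apply: measurable_fun_ler => //; exact: measurable_l1norm_mulmx.
Qed.

Lemma ge0_markov (R : realType) (d : measure_display) (T : measurableType d)
    (P : {measure set T -> \bar R}) (A : set T) (Y : T -> R) (t e : R) :
  measurable A -> measurable_fun setT Y -> (forall w, 0 <= Y w) -> 0 < t ->
  (forall w, A w -> t <= Y w) ->
  (\int[P]_w (Y w)%:E <= e%:E)%E -> (P A <= (e / t)%:E)%E.
Proof.
move=> mA mY Y0 t0 AY YE.
rewrite mulrC EFinM -[P A]mul1e -(@divff _ t) ?gt_eqF// mulrC EFinM -muleA.
rewrite lee_pmul2l// ?lte_fin ?invr_gt0//.
apply: le_trans YE; rewrite -(setIT A) -integral_indic//.
rewrite -ge0_integralZl//; last 2 first.
- by apply/measurable_EFinP.
- by rewrite lee_fin ltW.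
apply: ge0_le_integral => //.
- by move=> w _; rewrite mule_ge0// lee_fin// ltW.
- by apply: measurable_funeM; apply/measurable_EFinP.
- exact/measurable_EFinP.
move=> w _; rewrite indicE; have [/set_mem/AY|_] := boolP (w \in A).
  by rewrite mule1 lee_fin.
by rewrite mule0 lee_fin.
Qed.

(** Chernoff's bound: $e^{\|Gu\|_1}$ is at most the product over the rows of
    $e^{(Gu)_i} + e^{-(Gu)_i}$, whose mean is at most
    $(2e^{1/2})^n \le e^{2n}$. *)
Lemma gaussian_l1norm_upper (R : realType) (d : measure_display)
    (T : measurableType d) (P : probability T R) (n m : nat)
    (G : 'I_n -> 'I_m -> {RV P >-> R}) (u : 'cV[R]_m) :
  gaussian_matrix G -> sqnorm u <= 1 ->
  (P [set w | (4 * n%:R <= l1norm (matrix_at G w *m u))%R]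
     <= (expR (- (2 * n%:R)))%:E)%E.
Proof.
move=> GG u1.
pose th (b : bool) : R := if b then 1 else - 1.
pose Y w := \prod_i \sum_(b : bool) 1 * expR (th b * (matrix_at G w *m u) i 0).
have Y0 w : 0 <= Y w.
  by apply: prodr_ge0 => i _; apply: sumr_ge0 => b _; rewrite mul1r expR_ge0.
have -> : expR (- (2 * n%:R)) = expR (2 * n%:R) / expR (4 * n%:R) :> R.
  by rewrite -expRN -expRD; congr expR; ring.
apply: (@ge0_markov _ _ _ _ _ Y).
- exact: measurable_l1norm_ge.
- apply: measurable_prod => i _; apply: measurable_sum => b.
  apply: measurable_funM => //; apply: measurableT_comp => //.
  by apply: measurable_funM => //; exact: measurable_matrix_mulmx.
- exact: Y0.
- exact: expR_gt0.
- move=> w /= H; apply: (@le_trans _ _ (expR (l1norm (matrix_at G w *m u)))).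
    by rewrite ler_expR.
  rewrite expR_sum; apply: ler_prod => i _; rewrite expR_ge0/=.
  rewrite big_bool /th /= !mul1r mulN1r.
  set x := (_ *m _) i 0.
  by case: (ger0P x) => _; rewrite ?lerDl ?lerDr expR_ge0.
- rewrite /Y gaussian_rows_expR_sum// lee_fin big_bool/= /th !mul1r sqrrN expr1n.
  have -> : expR (2 * n%:R) = expR 2 ^+ n :> R by rewrite mulrC expRM_natl.
  apply: lerXn2r; rewrite ?nnegrE ?addr_ge0 ?expR_ge0//.
  have e1 : expR (1 * sqnorm u / 2) <= expR 1 :> R by rewrite ler_expR; lra.
  have e2 : 1 + 1 <= expR 1 :> R by exact: expR_ge1Dx.
  have e0 : 0 <= expR 1 :> R by exact: expR_ge0.
  have -> : expR 2 = expR 1 * expR 1 :> R by rewrite -expRD.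
  nra.
Qed.

(** The exponential polynomial $1/16 + (1 - (\cosh x - 1)/4)^2$: it is at
    least $e^{-8|x|}$ and yet has Gaussian mean less than 1, thanks to the dip
    near $\cosh x = 5$. *)
Definition dip_coef (R : realType) (k : 'I_5) : R :=
  [:: 1/64; - (5/16); 53/32; - (5/16); 1/64]`_k.

Definition dip_freq (R : realType) (k : 'I_5) : R := k%:R - 2.

Lemma dip_ge (R : realType) (x : R) :
  expR (- (8 * `|x|)) <= \sum_k dip_coef R k * expR (dip_freq R k * x).
Proof.
set y := `|x|.
have y0 : 0 <= y by exact: normr_ge0.
have -> : \sum_k dip_coef R k * expR (dip_freq R k * x) =
    1/16 + (5/4 - (expR y + expR (- y)) / 8) ^+ 2.
  have sgn : expR x + expR (- x) = expR y + expR (- y).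
    by rewrite /y; case: (ger0P x) => // _; rewrite opprK addrC.
  rewrite -sgn !big_ord_recl big_ord0 /dip_coef /dip_freq /= /bump /=.
  have -> : expR ((0%:R - 2) * x) = expR (- x) ^+ 2.
    by rewrite -expRM_natl; congr expR; ring.
  have -> : expR ((1 - 2) * x) = expR (- x) by congr expR; ring.
  have -> : expR ((2 - 2) * x) = expR x * expR (- x).
    by rewrite -expRD; congr expR; ring.
  have -> : expR ((3 - 2) * x) = expR x by congr expR; ring.
  have -> : expR ((4 - 2) * x) = expR x ^+ 2.
    by rewrite -expRM_natl; congr expR; ring.
  have : expR x * expR (- x) = 1 by rewrite -expRD subrr expR0.
  move: (expR x) (expR (- x)) => E E' EE'.
  have -> : (5 / 4 - (E + E') / 8) ^+ 2 =
    25/16 - 5/16 * (E + E') + (E ^+ 2 + E' ^+ 2 + 2 * (E * E')) / 64 by field.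
  by rewrite EE'; field.
(* Away from the origin the constant term is enough; near it cosh y - 1 is at
   most 2y/3. *)
have [y2|y2] := leP (1/2) y.
  have : expR (- (8 * y)) <= 1/16.
    have -> : expR (- (8 * y)) = (expR (2 * y) ^+ 4)^-1.
      by rewrite -expRM_natl -expRN; congr expR; ring.
    have e2 : 2 <= expR (2 * y).
      by apply: (le_trans _ (expR_ge1Dx _)); lra.
    rewrite div1r lef_pV2 ?posrE ?exprn_gt0 ?expR_gt0//.
    have : 4 <= expR (2 * y) ^+ 2 by nra.
    have -> : expR (2 * y) ^+ 4 = (expR (2 * y) ^+ 2) ^+ 2 by rewrite -exprM.
    by move: (expR _ ^+ 2) => z; nra.
  by have := sqr_ge0 (5 / 4 - (expR y + expR (- y)) / 8); lra.
have e1 : expR y <= (1 - y)^-1.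
  rewrite -[leLHS]invrK -expRN lef_pV2 ?posrE ?expR_gt0//; last lra.
  by apply: (le_trans _ (expR_ge1Dx _)).
have e2 : expR (- y) <= (1 + y)^-1.
  by rewrite expRN lef_pV2 ?posrE ?expR_gt0 ?expR_ge1Dx//; lra.
have e3 : expR (- (4 * y)) <= (1 + 4 * y)^-1.
  by rewrite expRN lef_pV2 ?posrE ?expR_gt0 ?expR_ge1Dx//; lra.
have e4 : (1 + 4 * y)^-1 <= 1 - y / 6.
  rewrite -[leLHS]mul1r ler_pdivrMr; last lra.
  by nra.
have e5 : (1 - y)^-1 + (1 + y)^-1 <= 2 + 4/3 * y.
  have -> : (1 - y)^-1 + (1 + y)^-1 = 2 / (1 - y ^+ 2).
    have n1 : 1 - y != 0 by apply/eqP; lra.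
    have n2 : 1 + y != 0 by apply/eqP; lra.
    have n3 : 1 - y ^+ 2 != 0 by apply/eqP; nra.
    by field; rewrite n1 n2 n3.
  rewrite ler_pdivrMr; last nra.
  have : 0 <= y * (1/2 - y) by nra.
  by nra.
have -> : expR (- (8 * y)) = expR (- (4 * y)) ^+ 2.
  by rewrite -expRM_natl; congr expR; ring.
have e0 := expR_ge0 (- (4 * y)).
suff : expR (- (4 * y)) ^+ 2 <= (5 / 4 - (expR y + expR (- y)) / 8) ^+ 2 by lra.
by apply: lerXn2r; rewrite ?nnegrE; lra.
Qed.

Lemma dip_meanE (R : realType) :
  \sum_k dip_coef R k * expR (dip_freq R k ^+ 2 * 1 / 2) =
  53/32 - 5/8 * expR (1/2) + expR 2 / 32.
Proof.
rewrite !big_ord_recl big_ord0 /dip_coef /dip_freq /= /bump /=.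
have -> : expR ((0%:R - 2) ^+ 2 * 1 / 2) = expR 2 :> R by congr expR; field.
have -> : expR ((1 - 2) ^+ 2 * 1 / 2) = expR (1/2) :> R by congr expR; field.
have -> : expR ((2 - 2) ^+ 2 * 1 / 2) = 1 :> R by rewrite -expR0; congr expR; field.
have -> : expR ((3 - 2) ^+ 2 * 1 / 2) = expR (1/2) :> R by congr expR; field.
have -> : expR ((4 - 2) ^+ 2 * 1 / 2) = expR 2 :> R by congr expR; field.
by field.
Qed.

Lemma dip_mean_ge0 (R : realType) :
  0 <= \sum_k dip_coef R k * expR (dip_freq R k ^+ 2 * 1 / 2).
Proof.
rewrite dip_meanE; have e0 := expR_ge0 (2 : R).
suff : expR (1/2) <= 2 :> R by lra.
rewrite -[leLHS]invrK -expRN -[leRHS]invrK lef_pV2 ?posrE ?expR_gt0 ?invr_gt0//.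
by apply: (le_trans _ (expR_ge1Dx _)); lra.
Qed.

(** The mean is about 0.857, which leaves room for crude bounds of
    $e^{1/2}$ and $e^2$ by powers of $1 + 1/8$ and of $1/(1 - 1/6)$. *)
Lemma dip_mean_le (R : realType) :
  \sum_k dip_coef R k * expR (dip_freq R k ^+ 2 * 1 / 2) <= expR (- (3 / 100)).
Proof.
rewrite dip_meanE; apply: (@le_trans _ _ (1 - 3 / 100)); last exact: expR_ge1Dx.
have e1 : (9/8) ^+ 4 <= expR (1/2) :> R.
  have -> : 1/2 = 4%:R * (1/8) :> R by field.
  rewrite expRM_natl; apply: lerXn2r; rewrite ?nnegrE ?expR_ge0//.
  by apply: (le_trans _ (expR_ge1Dx _)); lra.
have e2 : expR 2 <= (6/5) ^+ 12 :> R.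
  have -> : 2 = 12%:R * (1/6) :> R by field.
  rewrite expRM_natl; apply: lerXn2r; rewrite ?nnegrE ?expR_ge0//.
  rewrite -[leLHS]invrK -expRN -[leRHS]invrK lef_pV2 ?posrE ?expR_gt0 ?invr_gt0//.
  by apply: (le_trans _ (expR_ge1Dx _)); lra.
have : (6/5) ^+ 12 <= 9 :> R by rewrite !exprS expr0; lra.
move: e1; rewrite !exprS expr0; lra.
Qed.

(** Where $\|Gu\|_1 \le n/800$ the product over the rows of the exponential
    polynomial above is at least $e^{-n/100}$, whereas its mean is at most
    $e^{-3n/100}$. *)
Lemma gaussian_l1norm_lower (R : realType) (d : measure_display)
    (T : measurableType d) (P : probability T R) (n m : nat)
    (G : 'I_n -> 'I_m -> {RV P >-> R}) (u : 'cV[R]_m) :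
  gaussian_matrix G -> sqnorm u = 1 ->
  (P [set w | (l1norm (matrix_at G w *m u) <= n%:R / 800)%R]
     <= (expR (- (n%:R / 50)))%:E)%E.
Proof.
move=> GG u1.
pose Y w := \prod_(i < n) \sum_k dip_coef R k *
  expR (dip_freq R k * (matrix_at G w *m u) i 0).
have Yi0 x : 0 <= \sum_k dip_coef R k * expR (dip_freq R k * x).
  by apply: (le_trans _ (dip_ge x)); exact: expR_ge0.
have -> : expR (- (n%:R / 50)) =
    expR (- (3 / 100 * n%:R)) / expR (- (n%:R / 100)) :> R.
  by rewrite -expRN -expRD; congr expR; field.
apply: (@ge0_markov _ _ _ _ _ Y).
- exact: measurable_l1norm_le.
- apply: measurable_prod => i _; apply: measurable_sum => b.
  apply: measurable_funM => //; apply: measurableT_comp => //.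
  by apply: measurable_funM => //; exact: measurable_matrix_mulmx.
- by move=> w; apply: prodr_ge0 => i _; exact: Yi0.
- exact: expR_gt0.
- move=> w /= H.
  apply: (@le_trans _ _ (expR (- (8 * l1norm (matrix_at G w *m u))))).
    by rewrite ler_expR; lra.
  rewrite /l1norm mulr_sumr -sumrN expR_sum.
  by apply: ler_prod => i _; rewrite expR_ge0/=; exact: dip_ge.
- rewrite /Y gaussian_rows_expR_sum// lee_fin u1.
  have -> : expR (- (3 / 100 * n%:R)) = expR (- (3 / 100)) ^+ n :> R.
    by rewrite -mulNr mulrC expRM_natl.
  apply: lerXn2r; rewrite ?nnegrE ?expR_ge0//; first exact: dip_mean_ge0.
  exact: dip_mean_le.
Qed.

(** * Lattice approximation of sparse vectors *)

Lemma sum_geometric_le (R : realFieldType) (x : R) (N : nat) :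
  0 <= x -> x < 1 -> \sum_(i < N) x ^+ i <= (1 - x)^-1.
Proof.
move=> x0 x1; rewrite -[leRHS]mul1r ler_pdivlMr ?subr_gt0//.
have := subrX1 x N; have := exprn_ge0 N x0; set S := \sum_(_ < _) _.
lra.
Qed.

(** Weighing [f] by $x^{\sum f}$ turns the sum over all [f] into a product of
    geometric series. *)
Lemma card_small_sum (R : realType) (I : finType) (N M : nat) (x : R) :
  0 < x -> x <= 1/2 ->
  #|[set f : {ffun I -> 'I_N} | (\sum_i f i <= M)%N]%SET|%:R <=
    x ^- M * expR (2 * x * #|I|%:R).
Proof.
move=> x0 x2; set S := finset _.
rewrite mulrC ler_pdivlMr ?exprn_gt0//.
have -> : expR (2 * x * #|I|%:R) = \prod_(i : I) expR (2 * x) :> R.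
  by rewrite prodr_const -expRM_natl [in RHS]mulrC.
apply: (@le_trans _ _ (\prod_(i : I) \sum_(a < N) x ^+ a)); last first.
  apply: ler_prod => i _; apply/andP; split.
    by apply: sumr_ge0 => a _; apply: exprn_ge0; exact: ltW.
  apply: (le_trans (sum_geometric_le _ (ltW x0) _)); first lra.
  rewrite -[leRHS]invrK lef_pV2 ?posrE ?invr_gt0 ?expR_gt0//; last lra.
  rewrite -[leLHS]mul1r ler_pdivrMr ?expR_gt0//.
  have : 1 + 2 * x <= expR (2 * x) by exact: expR_ge1Dx.
  nra.
rewrite bigA_distr_bigA/= -sum1_card natr_sum mulr_suml.
rewrite [leRHS](bigID (mem S))/=; apply: ler_wpDr.
  by apply: sumr_ge0 => f _; apply: prodr_ge0 => i _; apply: exprn_ge0; exact: ltW.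
apply: ler_sum => f; rewrite inE mul1r => fM.
rewrite -expr_sum; apply: ler_wiXn2l => //; lra.
Qed.

Lemma l1norm_ge0 (R : realType) (m : nat) (x : 'cV[R]_m) : 0 <= l1norm x.
Proof. exact: sumr_ge0. Qed.

Lemma l1normD (R : realType) (m : nat) (x y : 'cV[R]_m) :
  l1norm (x + y) <= l1norm x + l1norm y.
Proof.
by rewrite -big_split/=; apply: ler_sum => i _; rewrite mxE ler_normD.
Qed.

Lemma l1normN (R : realType) (m : nat) (x : 'cV[R]_m) : l1norm (- x) = l1norm x.
Proof. by apply: eq_bigr => i _; rewrite mxE normrN. Qed.

Lemma l1normZ (R : realType) (m : nat) a (x : 'cV[R]_m) :
  l1norm (a *: x) = `|a| * l1norm x.
Proof. by rewrite mulr_sumr; apply: eq_bigr => i _; rewrite mxE normrM. Qed.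

Lemma sqnorm_ge0 (R : realType) (m : nat) (x : 'cV[R]_m) : 0 <= sqnorm x.
Proof. by apply: sumr_ge0 => i _; exact: sqr_ge0. Qed.

Lemma sqnormZ (R : realType) (m : nat) a (x : 'cV[R]_m) :
  sqnorm (a *: x) = a ^+ 2 * sqnorm x.
Proof. by rewrite mulr_sumr; apply: eq_bigr => i _; rewrite mxE exprMn. Qed.

Lemma sqnorm_le_entry (R : realType) (m : nat) (x : 'cV[R]_m) j :
  sqnorm x <= 1 -> `|x j 0| <= 1.
Proof.
move=> x1; rewrite -(@ler_pXn2r _ 2) ?nnegrE// expr1n real_normK ?num_real//.
apply: le_trans x1; rewrite /sqnorm (bigD1 j)//= lerDl.
by apply: sumr_ge0 => i _; exact: sqr_ge0.
Qed.

Lemma sqnorm_eq0 (R : realType) (m : nat) (x : 'cV[R]_m) :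
  sqnorm x = 0 -> x = 0.
Proof.
move=> x0; apply/colP => j; rewrite mxE.
have := sqnorm_ge0 x; rewrite /sqnorm in x0 *.
move: x0 => /eqP; rewrite psumr_eq0; last by move=> i _; exact: sqr_ge0.
by move=> /allP/(_ j (mem_index_enum _)); rewrite sqrf_eq0 => /eqP.
Qed.

Definition col_supp (R : realType) (m : nat) (x : 'cV[R]_m) : {set 'I_m} :=
  [set j | x j 0 != 0]%SET.

Lemma sum_col_supp (R : realType) (m : nat) (x : 'cV[R]_m) :
  \sum_j (x j 0 != 0)%:R = #|col_supp x|%:R :> R.
Proof.
rewrite -sum1_card natr_sum [RHS]big_mkcond; apply: eq_bigr => j _.
by rewrite inE; case: (_ != 0).
Qed.

(** The lattice $(1/(A\sqrt k))\mathbb Z^m$; a coordinate is given by its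
    positive and negative parts so that the size of [f] is a plain sum. *)
Definition netpt (R : realType) (m k A N : nat)
    (f : {ffun 'I_m * bool -> 'I_N}) : 'cV[R]_m :=
  \col_j (((f (j, true) : nat)%:R - (f (j, false) : nat)%:R)
          / (A%:R * Num.sqrt k%:R)).

(** Rounding the coordinates of a sparse vector towards zero, which keeps it
    sparse.  Sparsity bounds the $\ell_1$ norm of the lattice point, hence the
    number of lattice points that occur. *)
Lemma sparse_rounding (R : realType) (m k A : nat) (u : 'cV[R]_m) :
  (0 < k)%N -> (0 < A)%N -> (#|col_supp u| <= k)%N -> sqnorm u <= 1 ->
  exists f : {ffun 'I_m * bool -> 'I_(k * A).+1},
    let z := netpt R k A f in
    [/\ (\sum_i f i <= k * A)%N, sqnorm z <= sqnorm u,
        col_supp (u - z) \subset col_supp u & sqnorm (u - z) <= (A%:R ^+ 2)^-1].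
Proof.
move=> k0 A0 uk u1.
have sk0 : 0 < Num.sqrt k%:R :> R by rewrite sqrtr_gt0 ltr0n.
set D := A%:R * Num.sqrt k%:R : R.
have D0 : 0 < D by rewrite mulr_gt0 ?ltr0n.
pose t j := Num.truncn (`|u j 0| * D).
have t_le j : (t j)%:R <= `|u j 0| * D by rewrite truncn_le mulr_ge0// ltW.
have t_gt j : `|u j 0| * D < (t j).+1%:R by exact: truncnS_gt.
have t_kA j : (t j < (k * A).+1)%N.
  rewrite ltnS -(ler_nat R); apply: (le_trans (t_le j)).
  apply: (@le_trans _ _ (1 * D)).
    by rewrite ler_wpM2r ?(ltW D0)//; exact: sqnorm_le_entry.
  rewrite mul1r /D natrM mulrC ler_wpM2r//.
  rewrite -[leRHS]sqr_sqrtr// expr2 ler_peMl ?(ltW sk0)//.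
  by rewrite -[leLHS]sqrtr1 ler_wsqrtr// ler1n.
pose f := [ffun jb : 'I_m * bool =>
  if jb.2 == (0 <= u jb.1 0) then (inord (t jb.1) : 'I_(k * A).+1) else ord0].
exists f.
set z := netpt R k A f; rewrite /=.
have zE j : z j 0 = Num.sg (u j 0) * ((t j)%:R / D).
  rewrite mxE !ffunE/= -/D.
  have [uj|uj|uj] := ltgtP (u j 0) 0.
  - by rewrite ltr0_sg//= inordK// sub0r mulN1r mulNr.
  - by rewrite gtr0_sg//= inordK// subr0 mul1r.
  - by rewrite /= inordK// /t uj normr0 mul0r truncn0 sgr0 subr0 !mul0r.
have rE j : (u - z) j 0 = u j 0 - z j 0 by rewrite [LHS]mxE [X in _ + X = _]mxE.
have zle j : `|z j 0| <= `|u j 0|.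
  rewrite zE normrM normr_sg; case: eqP => [->|_]; rewrite ?mul0r ?mul1r//.
  rewrite ger0_norm ?divr_ge0// ?(ltW D0)// ler_pdivrMr//.
have rle j : `|u j 0 - z j 0| <= (u j 0 != 0)%:R / D.
  have [uj|uj] := eqVneq (u j 0) 0.
    by rewrite zE uj sgr0 mul0r subr0 normr0 mul0r.
  rewrite zE {1}[u j 0]numEsg -mulrBr normrM normr_sg uj !mul1r.
  rewrite ger0_norm; last by rewrite subr_ge0 ler_pdivrMr.
  have : `|u j 0| < (t j).+1%:R / D by rewrite ltr_pdivlMr.
  by rewrite -natr1 mulrDl mul1r /=; lra.
split.
- rewrite -(ler_nat R) natr_sum.
  rewrite (eq_bigr (fun jb : 'I_m * bool => (f (jb.1, jb.2) : nat)%:R)); last by case.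
  rewrite -(pair_bigA _ (fun j b => (f (j, b) : nat)%:R))/=.
  apply: (@le_trans _ _ (\sum_j A%:R * ((k%:R * u j 0 ^+ 2 + (u j 0 != 0)%:R) / 2))).
    apply: ler_sum => j _; rewrite big_bool/= !ffunE/=.
    have -> : ((if true == (0 <= u j 0) then inord (t j) : 'I_(k * A).+1 else ord0) : nat)%:R +
      ((if false == (0 <= u j 0) then inord (t j) : 'I_(k * A).+1 else ord0) : nat)%:R = (t j)%:R :> R.
      by case: (0 <= _); rewrite /= inordK// ?addr0 ?add0r.
    apply: (le_trans (t_le j)); rewrite /D mulrCA ler_wpM2l//.
    have [->|uj] := eqVneq (u j 0) 0.
      by rewrite normr0 mul0r expr0n mulr0 addr0 mul0r.
    (* 2ab <= a^2 + b^2 with a = sqrt k |u_j| and b = 1. *)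
    rewrite -[u j 0 ^+ 2]real_normK ?num_real// -[k%:R in leRHS]sqr_sqrtr//.
    have := sqr_ge0 (Num.sqrt k%:R * `|u j 0| - 1 : R).
    set a := Num.sqrt _; set b := `|_|; rewrite sqrrB1 exprMn /=; lra.
  rewrite -mulr_sumr -mulr_suml big_split/= -mulr_sumr -/(sqnorm u).
  rewrite sum_col_supp natrM mulrC ler_wpM2r// ler_pdivrMr//.
  have : #|col_supp u|%:R <= k%:R :> R by rewrite ler_nat.
  have : k%:R * sqnorm u <= k%:R * 1 by apply: ler_wpM2l.
  lra.
- apply: ler_sum => j _.
  by rewrite -[leLHS]real_normK ?num_real// -[leRHS]real_normK ?num_real// lerXn2r.
- apply/fintype.subsetP => j; rewrite !inE; apply: contra_neq => uj.
  by rewrite rE zE uj sgr0 mul0r subr0.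
- apply: (@le_trans _ _ (\sum_j (u j 0 != 0)%:R / D ^+ 2)).
    apply: ler_sum => j _; rewrite rE -[leLHS]real_normK ?num_real//.
    apply: (@le_trans _ _ (((u j 0 != 0)%:R / D) ^+ 2)).
      by rewrite lerXn2r// nnegrE divr_ge0// ltW.
    by case: (_ != 0); rewrite ?mul0r ?expr0n//= expr_div_n expr1n.
  rewrite -mulr_suml sum_col_supp /D exprMn sqr_sqrtr// invfM mulrCA.
  rewrite ler_piMr ?invr_ge0 ?exprn_ge0// ler_pdivrMr ?ltr0n// mul1r.
  by rewrite ler_nat.
Qed.

Lemma l1norm_mulmx_le (R : realType) (n m : nat) (M : 'M[R]_(n, m))
    (u : 'cV[R]_m) :
  sqnorm u <= 1 -> l1norm (M *m u) <= \sum_i \sum_j `|M i j|.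
Proof.
move=> u1; apply: ler_sum => i _; rewrite mxE.
apply: (le_trans (ler_norm_sum _ _ _)); apply: ler_sum => j _.
by rewrite normrM ler_piMr//; exact: sqnorm_le_entry.
Qed.

Lemma le_of_le_addr_half (R : realType) (x y B : R) :
  0 <= B -> (forall i, x <= y + B / 2 ^+ i) -> x <= y.
Proof.
move=> B0 H; apply/ler_addgt0Pr => e e0.
have := H (Num.truncn (B / e)); set i := Num.truncn _.
move=> /le_trans; apply; rewrite lerD2l ler_pdivrMr ?exprn_gt0//.
have Bi : B / e < i.+1%:R by exact: truncnS_gt.
have ii : i.+1%:R <= 2 ^+ i :> R by rewrite -natrX ler_nat ltn_expl.
by rewrite mulrC -ler_pdivrMr// (le_trans (ltW Bi)).
Qed.

(** Bounds on the lattice extend to all sparse vectors: the rounding error is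
    again sparse and $A$ times shorter, so that it can be absorbed, first in
    the upper bound by iterating, and then in the lower one. *)
Lemma sparse_bounds_of_net (R : realType) (n m k A : nat) (M : 'M[R]_(n, m))
    (a b : R) :
  (0 < k)%N -> (1 < A)%N -> 0 <= b -> 4 * b <= a * A%:R ->
  (forall f : {ffun 'I_m * bool -> 'I_(k * A).+1}, (\sum_i f i <= k * A)%N ->
    sqnorm (netpt R k A f) <= 1 ->
    l1norm (M *m netpt R k A f) <= b /\
    (1/4 <= sqnorm (netpt R k A f) -> a <= l1norm (M *m netpt R k A f))) ->
  forall u, (#|col_supp u| <= k)%N ->
    a / 2 * Num.sqrt (sqnorm u) <= l1norm (M *m u) <= 2 * b * Num.sqrt (sqnorm u).
Proof.
move=> k0 A1 b0 abA net.
have A0 : (0 < A)%N by rewrite (ltn_trans _ A1).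
have AR : 2 <= A%:R :> R by rewrite (ler_nat R 2).
have Agt0 : 0 < A%:R :> R by rewrite ltr0n.
set B := \sum_i \sum_j `|M i j|.
have B0 : 0 <= B by apply: sumr_ge0 => i _; exact: sumr_ge0.
have split_round u : (#|col_supp u| <= k)%N -> sqnorm u <= 1 ->
    exists z v, [/\ u = z + A%:R^-1 *: v, (#|col_supp v| <= k)%N,
      sqnorm v <= 1, l1norm (M *m z) <= b & sqnorm u = 1 -> a <= l1norm (M *m z)].
  move=> uk u1.
  have [f [fk zu ru rA]] := sparse_rounding k0 A0 uk u1.
  set z := netpt R k A f in zu ru rA *.
  have z1 : sqnorm z <= 1 by exact: le_trans u1.
  have [zb za] := net f fk z1.
  exists z, (A%:R *: (u - z)); split => //.
  - by rewrite scalerA mulVf ?gt_eqF// scale1r addrC subrK.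
  - apply: leq_trans uk; apply: subset_leq_card; apply: fintype.subset_trans ru.
    apply/fintype.subsetP => j; rewrite !inE; apply: contra_neq => uj.
    by rewrite mxE uj mulr0.
  - by rewrite sqnormZ -ler_pdivlMl ?exprn_gt0// mulr1.
  - move=> uE; apply: za.
    have : sqnorm u <= 2 * sqnorm z + 2 * sqnorm (u - z).
      rewrite /sqnorm !mulr_sumr -big_split/=; apply: ler_sum => j _.
      rewrite [X in _ <= _ + 2 * X ^+ 2]mxE [X in _ <= _ + 2 * (_ + X) ^+ 2]mxE.
      have := sqr_ge0 (u j 0 - 2 * z j 0); nra.
    have : (A%:R ^+ 2)^-1 <= 1 / 4 :> R.
      by rewrite div1r lef_pV2 ?posrE ?exprn_gt0//; nra.
    lra.
have up1 u : (#|col_supp u| <= k)%N -> sqnorm u <= 1 -> l1norm (M *m u) <= 2 * b.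
  move=> uk u1; apply: (@le_of_le_addr_half _ _ _ B) => // i.
  elim: i u uk u1 => [|i IHi] u uk u1.
    by rewrite expr0 divr1 ler_wpDl ?mulr_ge0//; exact: l1norm_mulmx_le.
  have [z [v [-> vk v1 zb _]]] := split_round u uk u1.
  rewrite mulmxDr -scalemxAr; apply: (le_trans (l1normD _ _)); rewrite l1normZ.
  have := IHi v vk v1; have := l1norm_ge0 (M *m v).
  rewrite ger0_norm ?invr_ge0// exprS invfM mulrCA => v0 vb.
  have AV : A%:R^-1 <= 2^-1 :> R by rewrite lef_pV2 ?posrE.
  have : A%:R^-1 * l1norm (M *m v) <= 2^-1 * l1norm (M *m v) by rewrite ler_wpM2r.
  move: (B / 2 ^+ i) (A%:R^-1 * _) vb => X Y vb; lra.
have low1 u : (#|col_supp u| <= k)%N -> sqnorm u = 1 -> a / 2 <= l1norm (M *m u).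
  move=> uk u1.
  have [z [v [uE vk v1 _ za]]] := split_round u uk (eq_ind_r (fun x => x <= 1) (lexx 1) u1).
  have zE : z = u - A%:R^-1 *: v by rewrite uE addrK.
  have := za u1; rewrite zE mulmxBr -scalemxAr => az.
  have := l1normD (M *m u) (- (A%:R^-1 *: (M *m v))).
  rewrite l1normN l1normZ ger0_norm ?invr_ge0// => H.
  have : A%:R^-1 * l1norm (M *m v) <= A%:R^-1 * (2 * b).
    by rewrite ler_wpM2l ?invr_ge0//; exact: up1.
  have : A%:R^-1 * (2 * b) <= a / 2.
    by rewrite mulrC ler_pdivrMr//; lra.
  lra.
move=> u uk.
have [u0|u0] := eqVneq (sqnorm u) 0.
  by rewrite u0 sqrtr0 !mulr0 l1norm_ge0/= (sqnorm_eq0 u0) mulmx0 -(scale0r 0) l1normZ normr0 mul0r.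
have ugt0 : 0 < sqnorm u by rewrite lt_def u0 sqnorm_ge0.
have sgt0 : 0 < Num.sqrt (sqnorm u) by rewrite sqrtr_gt0.
set v := (Num.sqrt (sqnorm u))^-1 *: u.
have uE : u = Num.sqrt (sqnorm u) *: v by rewrite scalerA divff ?gt_eqF// scale1r.
have v1 : sqnorm v = 1.
  by rewrite sqnormZ exprVn sqr_sqrtr ?sqnorm_ge0// mulVf.
have vk : (#|col_supp v| <= k)%N.
  apply: leq_trans uk; apply: subset_leq_card.
  apply/fintype.subsetP => j; rewrite !inE; apply: contra_neq => uj.
  by rewrite mxE uj mulr0.
rewrite [in l1norm _]uE -scalemxAr l1normZ gtr0_norm// ![_ * Num.sqrt _]mulrC.
by rewrite !ler_pM2l// low1// up1// v1.
Qed.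

(** * Restricted isometry *)

Lemma measure_bigsetU_seq_le (R : realType) (d : measure_display)
    (T : measurableType d) (P : {measure set T -> \bar R}) (I : Type)
    (s : seq I) (E : I -> set T) (e : R) :
  (forall i, measurable (E i)) -> (forall i, (P (E i) <= e%:E)%E) ->
  (P (\big[setU/set0]_(i <- s) E i) <= ((size s)%:R * e)%:E)%E.
Proof.
move=> mE Pe; elim: s => [|i s IHs]; first by rewrite big_nil measure0 mul0r lexx.
rewrite big_cons /= -nat1r mulrDl mul1r EFinD.
have mU : measurable (\big[setU/set0]_(i <- s) E i) by exact: bigsetU_measurable.
exact: le_trans (measureU2 P (mE i) mU) (leeD (Pe i) IHs).
Qed.

(** With the weight $x = n/(Wm)$ the geometric series contribute only
    $e^{4n/W}$, so that for large $W$ it is $k\log(\mathrm em/n)$ that has to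
    be small compared with $n$. *)
Lemma card_net_le (R : realType) (n m k A N : nat) (W : R) :
  (0 < n)%N -> (n < m)%N -> 2 <= W ->
  #|[set f : {ffun 'I_m * bool -> 'I_N} | (\sum_i f i <= k * A)%N]%SET|%:R
    <= expR (k%:R * A%:R * (W * ln (expR 1 * m%:R / n%:R)) + 4 * n%:R / W) :> R.
Proof.
move=> n0 nm W2.
have nR : 0 < n%:R :> R by rewrite ltr0n.
have mR : 0 < m%:R :> R by rewrite ltr0n (ltn_trans n0).
have nmR : n%:R <= m%:R :> R by rewrite ler_nat ltnW.
have W0 : 0 < W by lra.
set L := ln _.
have eL : expR L = expR 1 * m%:R / n%:R.
  by rewrite lnK// posrE divr_gt0// mulr_gt0// expR_gt0.
have L1 : 1 <= L.
  rewrite -ler_expR eL ler_pdivlMr// ler_pM2l ?expR_gt0//.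
set x := n%:R / (W * m%:R) : R.
have x0 : 0 < x by rewrite divr_gt0// mulr_gt0.
have x2 : x <= 1/2 by rewrite ler_pdivrMr ?mulr_gt0//; nra.
apply: (le_trans (card_small_sum _ _ _ x0 x2)).
rewrite expRD; apply: ler_pM; rewrite ?expR_ge0 ?invr_ge0 ?exprn_ge0 ?(ltW x0)//.
  rewrite -natrM expRM_natl -exprVn lerXn2r ?nnegrE ?invr_ge0 ?(ltW x0) ?expR_ge0//.
  have -> : x^-1 = W * (m%:R / n%:R) by rewrite /x; field; rewrite !gt_eqF.
  have -> : W * L = (W - 1) * L + L by ring.
  rewrite expRD eL -mulrA; apply: ler_pM.
  - exact: ltW.
  - by rewrite divr_ge0// ltW.
  - by apply: (le_trans _ (expR_ge1Dx _)); nra.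
  - rewrite ler_peMl ?divr_ge0 ?(ltW mR) ?(ltW nR)//.
    by apply: (le_trans _ (expR_ge1Dx _)); lra.
rewrite ler_expR card_prod card_ord card_bool natrM /x.
by rewrite le_eqVlt; apply/orP; left; apply/eqP; field; rewrite !gt_eqF.
Qed.

(** The restricted isometry property, from $\ell_2$ to $\ell_1$.  The net has at
    most $e^{n/100}$ points and each violates its bounds with probability at
    most $2e^{-n/50}$. *)
Lemma gaussian_sparse_bounds (R : realType) :
  exists a b c : R, [/\ 0 < a, 0 < b, 0 < c &
  forall (n m k : nat) (d : measure_display) (T : measurableType d)
    (P : probability T R) (G : 'I_n -> 'I_m -> {RV P >-> R}),
  (0 < n)%N -> (n < m)%N -> (0 < k)%N ->
  k%:R * ln (expR 1 * m%:R / n%:R) <= c * n%:R ->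
  gaussian_matrix G ->
  with_prob_ge P (1 - 2 * expR (- (n%:R / 100)))
    [set w | forall u : 'cV[R]_m, (#|col_supp u| <= k)%N ->
      a * n%:R * Num.sqrt (sqnorm u) <= l1norm (matrix_at G w *m u)
        <= b * n%:R * Num.sqrt (sqnorm u)]].
Proof.
(* With W the geometric series contribute n/200 to the logarithm of the size of
   the net; with A the rounding error, at most 8n/A, is at most half of the lower
   bound tn/2 that holds on the net. *)
have [t [t0 t1 tE]] : exists t : R, [/\ 0 < t, t <= 1 & t = 1 / 800].
  by exists (1 / 800); split; lra.
have [W [W2 WE]] : exists W : R, 2 <= W /\ 4 / W = 1 / 200.
  by exists (2 * 400); split; [lra|field].
have [A [A1 AE]] : exists A : nat, (1 < A)%N /\ 4 * 4 <= t / 2 * A%:R.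
  exists (160 * 160)%N; split; first by [].
  by rewrite natrM tE; lra.
have A0 : 0 < A%:R :> R by rewrite ltr0n (ltn_trans _ A1).
have W0 : 0 < W by lra.
exists (t / 4), 8, (1 / (200 * (A%:R * W))); split.
- by rewrite divr_gt0.
- by [].
- by rewrite divr_gt0// mulr_gt0 ?mulr_gt0//; lra.
move=> n m k d T P G n0 nm k0 kL GG.
have nR : 0 < n%:R :> R by rewrite ltr0n.
pose z := @netpt R m k A (k * A).+1.
pose F := [set f : {ffun 'I_m * bool -> 'I_(k * A).+1} | (\sum_i f i <= k * A)%N]%SET.
have cF : #|F|%:R <= expR (n%:R / 100) :> R.
  apply: (le_trans (card_net_le k A _ n0 nm W2)); rewrite ler_expR.
  have -> : 4 * n%:R / W = n%:R * (4 / W) by rewrite mulrAC mulrC.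
  rewrite WE; set L := ln _ in kL *.
  have -> : k%:R * A%:R * (W * L) = k%:R * L * (A%:R * W) by ring.
  have : k%:R * L * (A%:R * W) <= 1 / (200 * (A%:R * W)) * n%:R * (A%:R * W).
    by rewrite ler_wpM2r ?mulr_ge0// ltW.
  have -> : 1 / (200 * (A%:R * W)) * n%:R * (A%:R * W) = n%:R / 200.
    by field; rewrite !gt_eqF.
  by lra.
pose y f := (Num.sqrt (sqnorm (z f)))^-1 *: z f.
pose E f := if sqnorm (z f) <= 1
  then [set w | 4 * n%:R <= l1norm (matrix_at G w *m z f)] else set0.
pose E' f := if 1/4 <= sqnorm (z f)
  then [set w | l1norm (matrix_at G w *m y f) <= n%:R * t] else set0.
have mE f : measurable (E f).
  by rewrite /E; case: ifP => _ //; exact: measurable_l1norm_ge.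
have mE' f : measurable (E' f).
  by rewrite /E'; case: ifP => _ //; exact: measurable_l1norm_le.
have PE f : (P (E f) <= (expR (- (n%:R / 50)))%:E)%E.
  rewrite /E; case: ifP => [zf|_]; last by rewrite measure0 lee_fin expR_ge0.
  apply: (le_trans (gaussian_l1norm_upper GG zf)).
  by rewrite lee_fin ler_expR; lra.
have sz f : 1/4 <= sqnorm (z f) -> 1/2 <= Num.sqrt (sqnorm (z f)).
  move=> zf; have -> : 1/2 = Num.sqrt (1/4) :> R.
    have -> : 1/4 = (1/2) ^+ 2 :> R by field.
    by rewrite sqrtr_sqr ger0_norm.
  by rewrite ler_wsqrtr.
have PE' f : (P (E' f) <= (expR (- (n%:R / 50)))%:E)%E.
  rewrite /E'; case: ifP => [zf|_]; last by rewrite measure0 lee_fin expR_ge0.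
  have -> : n%:R * t = n%:R / 800 by rewrite tE mulrA mulr1.
  apply: gaussian_l1norm_lower => //.
  have z0 : 0 < sqnorm (z f) by lra.
  by rewrite sqnormZ exprVn sqr_sqrtr ?sqnorm_ge0// mulVf// gt_eqF.
pose bad := \big[setU/set0]_(f <- enum F) (E f `|` E' f).
have mbad : measurable bad.
  by apply: bigsetU_measurable => f _; exact: measurableU.
exists (~` bad); split; first exact: measurableC.
- move=> w wbad; have good f : f \in F -> ~ E f w /\ ~ E' f w.
    move=> fF; have H : ~ (E f `|` E' f) w.
      move=> Ew; apply: wbad; rewrite /bad -bigcup_seq.
      by exists f => //; rewrite /= mem_enum.
    by split => Ew; apply: H; [left|right].
  have := @sparse_bounds_of_net R n m k A (matrix_at G w) (n%:R * t / 2) (4 * n%:R)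
    k0 A1 _ _ _.
  have -> : n%:R * t / 2 / 2 = t / 4 * n%:R by field.
  have -> : 2 * (4 * n%:R) = 8 * n%:R :> R by ring.
  apply.
  + by rewrite mulr_ge0.
  + have -> : n%:R * t / 2 * A%:R = n%:R * (t / 2 * A%:R) by ring.
    by rewrite mulrA mulrC ler_pM2l.
  + move=> f fk z1; have [|Ef E'f] := good f; first by rewrite inE.
    split=> [|zf].
      have := Ef; rewrite /E ifT// /mkset => /negP; rewrite -ltNge.
      exact: ltW.
    have := E'f; rewrite /E' ifT// /mkset => /negP; rewrite -ltNge.
    rewrite /y -scalemxAr l1normZ.
    have s2 := sz f zf; have s0 : 0 < Num.sqrt (sqnorm (z f)) by lra.
    rewrite ger0_norm ?invr_ge0 ?sqrtr_ge0// [_^-1 * _]mulrC ltr_pdivlMr// -/(z f).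
    have nt : 0 < n%:R * t by exact: mulr_gt0.
    by move: (Num.sqrt _) s2 (l1norm _) (n%:R * t) nt => s s2 l nt; nra.
- rewrite probability_setC//.
  have : (P bad <= (#|F|%:R * (2 * expR (- (n%:R / 50))))%:E)%E.
    rewrite cardE; apply: measure_bigsetU_seq_le => f; first exact: measurableU.
    apply: (le_trans (measureU2 P (mE f) (mE' f))).
    by rewrite mulr2n mulrDl mul1r EFinD; exact: leeD (PE f) (PE' f).
  move=> Pb; rewrite EFinB leeB//; apply: (le_trans Pb).
  rewrite lee_fin mulrCA ler_pM2l//.
  have -> : expR (- (n%:R / 100)) = expR (n%:R / 100) * expR (- (n%:R / 50)) :> R.
    by rewrite -expRD; congr expR; field.
  by rewrite ler_wpM2r ?expR_ge0.
Qed.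

(** * Kernel vectors with a flat tail *)

Lemma exists_top_subset (R : realType) (I : finType) (g : I -> R) (S : {set I})
    (s : nat) :
  exists J : {set I}, [/\ J \subset S, (#|J| <= s)%N &
    forall j, j \in S :\: J -> #|J| = s /\ forall i, i \in J -> g j <= g i].
Proof.
elim: s => [|s [J [JS Js topJ]]].
  by exists finset.set0; split; rewrite ?finset.sub0set ?cards0// => j _; split=> // i; rewrite inE.
have [SJ0|[j0 j0SJ]] := finset.set_0Vmem (S :\: J).
  by exists J; split=> //; [exact: leqW|move=> j; rewrite SJ0 inE].
case: (@arg_maxP _ _ _ j0 (mem (S :\: J)) g j0SJ) => j jSJ jmax.
have {}jSJ : j \in S :\: J by [].
have [Jcard Jmax] := topJ j jSJ.
have [jJ jS] : j \notin J /\ j \in S by move: jSJ; rewrite finset.in_setD => /andP[].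
exists (j |: J)%SET; split.
- by rewrite finset.subUset finset.sub1set jS.
- by rewrite cardsU1 jJ Jcard.
move=> i; rewrite !inE negb_or => /andP[/andP[ij iJ] iS].
have iSJ : i \in S :\: J by rewrite inE iJ.
split; first by rewrite cardsU1 jJ Jcard.
move=> l; rewrite !inE => /orP[/eqP ->|lJ]; first exact: jmax.
by have [_] := topJ i iSJ; exact.
Qed.

Lemma exists_top_subset_mean (R : realType) (I : finType) (g : I -> R)
    (S : {set I}) (s : nat) :
  exists J : {set I}, [/\ J \subset S, (#|J| <= s)%N &
    forall j, j \in S :\: J -> #|J| = s /\ s%:R * g j <= \sum_(i in J) g i].
Proof.
have [J [JS Js topJ]] := exists_top_subset g S s.
exists J; split => // j jSJ; have [Jcard Jmax] := topJ j jSJ; split => //.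
rewrite -Jcard -sum1_card natr_sum mulr_suml; apply: ler_sum => i iJ.
by rewrite mul1r; exact: Jmax.
Qed.

Definition col_restr (R : realType) (m : nat) (J : {set 'I_m}) (x : 'cV[R]_m) :
  'cV[R]_m := \col_j (if j \in J then x j 0 else 0).

Lemma col_restrD (R : realType) (m : nat) (J : {set 'I_m}) (x : 'cV[R]_m) :
  x = col_restr J x + col_restr (~: J) x.
Proof.
by apply/colP => j; rewrite !mxE inE; case: (j \in J); rewrite ?addr0 ?add0r.
Qed.

Lemma col_supp_col_restr (R : realType) (m : nat) (J : {set 'I_m}) (x : 'cV[R]_m) :
  col_supp (col_restr J x) = J :&: col_supp x.
Proof. by apply/finset.setP => j; rewrite !inE mxE; case: (j \in J); rewrite ?eqxx. Qed.

Lemma l1norm_col_restr (R : realType) (m : nat) (J : {set 'I_m}) (x : 'cV[R]_m) :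
  l1norm (col_restr J x) = \sum_(j in J) `|x j 0|.
Proof.
rewrite [RHS]big_mkcond; apply: eq_bigr => j _.
by rewrite mxE; case: (j \in J); rewrite ?normr0.
Qed.

Lemma sqnorm_col_restr (R : realType) (m : nat) (J : {set 'I_m}) (x : 'cV[R]_m) :
  sqnorm (col_restr J x) = \sum_(j in J) x j 0 ^+ 2.
Proof.
rewrite [RHS]big_mkcond; apply: eq_bigr => j _.
by rewrite mxE; case: (j \in J); rewrite ?expr0n.
Qed.

(** Shelling off the [s] largest coordinates: the [s] coordinates removed
    dominate the next ones, so that the maximum of the remainder is at most
    the mean of the block removed, and the means add up to the $\ell_1$ norm. *)
Lemma l1norm_mulmx_le_blocks (R : realType) (n m s : nat) (M : 'M[R]_(n, m))
    (b : R) :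
  (0 < s)%N -> 0 <= b ->
  (forall u : 'cV[R]_m, (#|col_supp u| <= s)%N ->
    l1norm (M *m u) <= b * Num.sqrt (sqnorm u)) ->
  forall (y : 'cV[R]_m) (t : R), (forall j, `|y j 0| <= t) ->
    0 <= t ->
    l1norm (M *m y) <= b * Num.sqrt s%:R * (t + l1norm y / s%:R).
Proof.
move=> s0 b0 Mb y.
have sR : 0 < s%:R :> R by rewrite ltr0n.
have small v t : (#|col_supp v| <= s)%N -> (forall j, `|v j 0| <= t) -> 0 <= t ->
    l1norm (M *m v) <= b * Num.sqrt s%:R * t.
  move=> vs vt t0; apply: (le_trans (Mb v vs)).
  rewrite -mulrA ler_wpM2l// -[t]ger0_norm// -sqrtr_sqr -sqrtrM ?(ltW sR)//.
  rewrite ler_wsqrtr//.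
  apply: (@le_trans _ _ (\sum_(j in col_supp v) t ^+ 2)).
    rewrite [leRHS]big_mkcond; apply: ler_sum => j _; rewrite inE.
    have [->|_] := eqVneq (v j 0) 0; first by rewrite expr0n.
    by rewrite -[leLHS]real_normK ?num_real// lerXn2r ?nnegrE.
  rewrite sumr_const -[leLHS]mulr_natl ler_wpM2r ?sqr_ge0//.
  by rewrite ler_nat.
have [N] := ubnP #|col_supp y|; elim: N y => // N IHN y yN t yt t0.
have bs0 : 0 <= b * Num.sqrt s%:R by rewrite mulr_ge0// sqrtr_ge0.
have [ys|sy] := leqP #|col_supp y| s.
  apply: (le_trans (small y t ys yt t0)).
  by rewrite ler_wpM2l// lerDl divr_ge0 ?l1norm_ge0// ltW.
have [J [JS Js topJ]] :=
  exists_top_subset_mean (fun j => `|y j 0|) (col_supp y) s.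
have [j0 j0J] : exists j, j \in col_supp y :\: J.
  apply/finset.set0Pn; rewrite -card_gt0 cardsD subn_gt0.
  apply: leq_ltn_trans sy; apply: leq_trans Js.
  exact: subset_leq_card (finset.subsetIr _ _).
have [Jcard _] := topJ j0 j0J.
set tau := (\sum_(j in J) `|y j 0|) / s%:R.
have tau0 : 0 <= tau by rewrite divr_ge0 ?sumr_ge0// ltW.
have ytau j : `|col_restr (~: J) y j 0| <= tau.
  rewrite mxE inE; case: ifPn => [jJ|_]; last by rewrite normr0.
  have [->|yj] := eqVneq (y j 0) 0; first by rewrite normr0.
  have [|_] := topJ j; first by rewrite !inE jJ.
  by rewrite /tau ler_pdivlMr// mulrC.
rewrite {1}[y](col_restrD J) mulmxDr; apply: (le_trans (l1normD _ _)).
have hJ : l1norm (M *m col_restr J y) <= b * Num.sqrt s%:R * t.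
  apply: small => //.
    by rewrite col_supp_col_restr (leq_trans (subset_leq_card (finset.subsetIl _ _))).
  by move=> j; rewrite mxE; case: ifP; rewrite ?normr0.
have hC : l1norm (M *m col_restr (~: J) y) <=
    b * Num.sqrt s%:R * (tau + l1norm (col_restr (~: J) y) / s%:R).
  apply: IHN => //.
  apply: (@leq_trans #|col_supp y|); last by rewrite -ltnS.
  rewrite col_supp_col_restr; apply: proper_card.
  apply/fintype.properP; split; first exact: finset.subsetIr.
  have [i iJ] : exists i, i \in J by apply/finset.set0Pn; rewrite -card_gt0 Jcard.
  by exists i; [exact: (fintype.subsetP JS)|rewrite !inE iJ].
apply: (le_trans (lerD hJ hC)); rewrite -mulrDr ler_wpM2l//.
rewrite lerD2l /tau -mulrDl ler_wpM2r ?invr_ge0 ?(ltW sR)//.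
rewrite l1norm_col_restr [leRHS](bigID (mem J))/=; rewrite lerD2l.
rewrite le_eqVlt; apply/orP; left; apply/eqP.
by apply: eq_bigl => j; rewrite inE.
Qed.

Lemma le_powR_interp (R : realType) (p r x e : R) :
  0 < p -> p <= r -> 0 <= x -> x <= e -> x `^ r <= e `^ (r - p) * x `^ p.
Proof.
move=> p0 pr x0 xe; have r0 : 0 < r by exact: lt_le_trans pr.
have [->|xn0] := eqVneq x 0; first by rewrite !powR0 ?gt_eqF// mulr0.
have -> : x `^ r = x `^ (r - p) * x `^ p.
  by rewrite -powRD ?subrK// xn0 implybT.
rewrite ler_wpM2r ?powR_ge0// ge0_ler_powR ?nnegrE ?subr_ge0//.
exact: le_trans xe.
Qed.

Lemma powR_le_sqr (R : realType) (q x : R) :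
  0 < q -> q <= 2 -> 0 <= x -> x `^ q <= 1 + x ^+ 2.
Proof.
move=> q0 q2 x0; have [x1|x1] := leP 1 x.
  apply: (@le_trans _ _ (x `^ 2)); first exact: ler_powR.
  by rewrite powR_mulrn// lerDr.
apply: (@le_trans _ _ 1); last by rewrite lerDl sqr_ge0.
have -> : 1 = 1 `^ q :> R by rewrite powR1.
rewrite ge0_ler_powR ?nnegrE//; exact: ltW.
Qed.

(** Outside [T] the vector [x] is flat, so that its image is small; as [M] kills
    [x], the part on [T] has an equally small image and, being sparse, is
    itself small. *)
Lemma kernel_powR_sum_le (R : realType) (n m s : nat) (M : 'M[R]_(n, m))
    (a b p q e : R) (x : 'cV[R]_m) (T : {set 'I_m}) :
  (0 < s)%N -> 0 < a -> 0 <= b -> 0 < p -> p <= 1 -> p < q -> q <= 2 -> 0 < e ->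
  (forall u : 'cV[R]_m, (#|col_supp u| <= 2 * s)%N ->
    a * Num.sqrt (sqnorm u) <= l1norm (M *m u) <= b * Num.sqrt (sqnorm u)) ->
  M *m x = 0 -> (#|T| <= 2 * s)%N ->
  (forall j, j \notin T -> `|x j 0| <= e) ->
  \sum_(j | j \notin T) `|x j 0| `^ p <= s%:R * e `^ p ->
  \sum_j `|x j 0| `^ q <= (3 + (2 * b / a) ^+ 2) * s%:R * e `^ q.
Proof.
move=> s0 a0 b0 p0 p1 pq q2 e0 Mab Mx0 Ts xe xp.
have sR : 0 < s%:R :> R by rewrite ltr0n.
have q0 : 0 < q by exact: lt_trans pq.
have tail r : p <= r -> \sum_(j | j \notin T) `|x j 0| `^ r <= s%:R * e `^ r.
  move=> pr.
  apply: (@le_trans _ _ (\sum_(j | j \notin T) e `^ (r - p) * `|x j 0| `^ p)).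
    by apply: ler_sum => j jT; apply: le_powR_interp => //; exact: xe.
  rewrite -mulr_sumr; apply: (le_trans (ler_wpM2l _ xp)); first exact: powR_ge0.
  by rewrite mulrCA -powRD ?subrK// (gt_eqF e0) implybT.
have yl1 : l1norm (col_restr (~: T) x) <= s%:R * e.
  have := tail 1 p1; rewrite powRr1 ?(ltW e0)// => /(le_trans _); apply.
  rewrite l1norm_col_restr le_eqVlt; apply/orP; left; apply/eqP.
  by apply: eq_big => [j|j _]; rewrite ?inE// powRr1.
have My : l1norm (M *m col_restr (~: T) x) <= 2 * b * Num.sqrt s%:R * e.
  have bl := @l1norm_mulmx_le_blocks R n m s M b s0 b0.
  have {}bl := bl _ (col_restr (~: T) x) e _ (ltW e0).
  apply: (le_trans (bl _ _)).
  - move=> u us; have us2 : (#|col_supp u| <= 2 * s)%N by rewrite (leq_trans us)// leq_pmull.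
    by have /andP[] := Mab u us2.
  - move=> j; rewrite mxE inE; case: ifPn => [|_]; first exact: xe.
    by rewrite normr0 ltW.
  have : l1norm (col_restr (~: T) x) / s%:R <= e by rewrite ler_pdivrMr// mulrC.
  have : 0 <= b * Num.sqrt s%:R by rewrite mulr_ge0 ?sqrtr_ge0.
  have -> : 2 * b * Num.sqrt s%:R * e = b * Num.sqrt s%:R * (2 * e) by ring.
  by move=> B0 le; rewrite ler_wpM2l//; lra.
have MT : M *m col_restr T x = - (M *m col_restr (~: T) x).
  by apply/eqP; rewrite -addr_eq0 -mulmxDr -col_restrD Mx0.
have xT : sqnorm (col_restr T x) <= (2 * b / a) ^+ 2 * s%:R * e ^+ 2.
  have T2 : (#|col_supp (col_restr T x)| <= 2 * s)%N.
    by rewrite col_supp_col_restr (leq_trans (subset_leq_card (finset.subsetIl _ _))).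
  have /andP[+ _] := Mab _ T2; rewrite MT l1normN => /le_trans/(_ My) H.
  rewrite -[leLHS]sqr_sqrtr ?sqnorm_ge0//.
  have -> : (2 * b / a) ^+ 2 * s%:R * e ^+ 2 = (2 * b / a * Num.sqrt s%:R * e) ^+ 2.
    by rewrite !exprMn sqr_sqrtr// ltW.
  have K0 : 0 <= 2 * b / a * Num.sqrt s%:R * e.
    by rewrite mulr_ge0 ?(ltW e0)// mulr_ge0 ?sqrtr_ge0// divr_ge0 ?(ltW a0)// mulr_ge0.
  rewrite lerXn2r ?nnegrE ?sqrtr_ge0//.
  have -> : 2 * b / a * Num.sqrt s%:R * e = 2 * b * Num.sqrt s%:R * e / a.
    by field; rewrite gt_eqF.
  by rewrite ler_pdivlMr// mulrC.
(* After scaling by e, t^q <= 1 + t^2 plays the role of Hoelder's inequality. *)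
have head : \sum_(j in T) `|x j 0| `^ q <= (2 + (2 * b / a) ^+ 2) * s%:R * e `^ q.
  apply: (@le_trans _ _ (\sum_(j in T) e `^ q * (1 + x j 0 ^+ 2 / e ^+ 2))).
    apply: ler_sum => j _.
    have -> : `|x j 0| = e * (`|x j 0| / e) by field; rewrite gt_eqF.
    rewrite powRM ?(ltW e0) ?divr_ge0 ?(ltW e0)// ler_wpM2l ?powR_ge0//.
    apply: (le_trans (powR_le_sqr q0 q2 _)); first by rewrite divr_ge0// ltW.
    by rewrite expr_div_n real_normK ?num_real.
  rewrite -mulr_sumr mulrC ler_wpM2r ?powR_ge0// big_split/= -mulr_suml.
  rewrite -sqnorm_col_restr sumr_const.
  have : #|T|%:R <= 2 * s%:R :> R by rewrite -natrM ler_nat.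
  have : sqnorm (col_restr T x) / e ^+ 2 <= (2 * b / a) ^+ 2 * s%:R.
    by rewrite ler_pdivrMr ?exprn_gt0.
  move: (_ / e ^+ 2) ((2 * b / a) ^+ 2) => X Y; lra.
rewrite (bigID (mem T))/=; apply: (le_trans (lerD head (tail q (ltW pq)))).
by rewrite le_eqVlt; apply/orP; left; apply/eqP; ring.
Qed.

(** * The ellipsoid *)

Lemma card_ord_lt_le (m s : nat) : (#|[set j : 'I_m | (j < s)%N]%SET| <= s)%N.
Proof.
case: s => [|s]; first by rewrite eq_card0// => j; rewrite inE ltn0.
rewrite -[leqRHS]card_ord.
apply: (@leq_card_in _ _ (fun j : 'I_m => inord j : 'I_s.+1)) => i j.
rewrite !inE => si sj /(congr1 val)/=; rewrite !inordK// => ij.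
exact: val_inj.
Qed.

(** The first [s] coordinates have the large semiaxes; the [s] largest among the
    others absorb the peaks of the remainder.  The threshold [e] is the one for
    which $s e^p = s^{-\lambda p}$, a bound for the sum of the $p$-th powers of
    the entries beyond the first [s]. *)
Lemma ellipsoid_flat_tail (R : realType) (p lambda : R) (sigma : nat -> R)
    (m s : nat) (x : 'cV[R]_m) :
  0 < p -> 0 < lambda -> (0 < s)%N ->
  (forall j, (0 < j)%N -> sigma j = j%:R `^ (- lambda)) ->
  ellipsoid p sigma m x ->
  exists T : {set 'I_m}, let e := s%:R `^ (- (lambda + p^-1)) in
    [/\ (#|T| <= 2 * s)%N, forall j, j \notin T -> `|x j 0| <= e &
      \sum_(j | j \notin T) `|x j 0| `^ p <= s%:R * e `^ p].
Proof.
move=> p0 l0 s0 sigmaE; rewrite /ellipsoid /= /lpnorm => xE.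
have sR : 0 < s%:R :> R by rewrite ltr0n.
pose J0 := [set j : 'I_m | (j < s)%N]%SET.
have wsum : \sum_(j in ~: J0) `|x j 0| `^ p <= s%:R `^ (- (lambda * p)).
  rewrite -[leRHS]mul1r powRN ler_pdivlMr ?powR_gt0// mulr_suml.
  apply: (@le_trans _ _ (\sum_(j < m)
      `|(\col_(j < m) (x j 0 / sigma j.+1)) j 0| `^ p)).
    rewrite big_mkcond; apply: ler_sum => j _; rewrite !inE mxE -leqNgt.
    case: ifPn => [sj|_]; last exact: powR_ge0.
    rewrite sigmaE// powRN invrK normrM powRM// ler_wpM2l ?powR_ge0//.
    rewrite ger0_norm ?powR_ge0// -powRrM.
    rewrite ge0_ler_powR ?nnegrE ?mulr_ge0 ?(ltW l0) ?(ltW p0)//.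
    by rewrite ler_nat leqW.
  move: xE; set S := \sum_(_ < m) _ => xE.
  have S0 : 0 <= S by apply: sumr_ge0 => j _; exact: powR_ge0.
  have -> : S = (S `^ p^-1) `^ p by rewrite -powRrM mulVf ?gt_eqF// powRr1.
  apply: (@le_trans _ _ (1 `^ p)); last by rewrite powR1.
  by rewrite ge0_ler_powR ?nnegrE ?powR_ge0// ltW.
have [J1 [J1S J1s topJ1]] :=
  exists_top_subset_mean (fun j => `|x j 0| `^ p) (~: J0) s.
exists (J0 :|: J1)%SET; set e := s%:R `^ _ => /=.
have ep : s%:R * e `^ p = s%:R `^ (- (lambda * p)).
  rewrite /e -powRrM -[X in X * _]powRr1 ?(ltW sR)// -powRD; last first.
    by rewrite (gt_eqF sR) implybT.
  by congr (_ `^ _); field; rewrite gt_eqF.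
split.
- rewrite mul2n -addnn (leq_trans (leq_card_setU _ _))// leq_add//.
  exact: card_ord_lt_le.
- move=> j; rewrite inE negb_or => /andP[jJ0 jJ1].
  have [|_ xj] := topJ1 j; first by rewrite !inE jJ1 -leqNgt leqNgt; rewrite inE in jJ0.
  have : s%:R * `|x j 0| `^ p <= s%:R * e `^ p.
    rewrite ep; apply: le_trans wsum; apply: (le_trans xj).
    rewrite [leRHS](bigID (mem J1))/=; apply: ler_wpDr.
      by apply: sumr_ge0 => i _; exact: powR_ge0.
    rewrite le_eqVlt; apply/orP; left; apply/eqP; apply: eq_bigl => i.
    by have [iJ|] := boolP (i \in J1); rewrite ?andbF// (fintype.subsetP J1S).
  rewrite ler_pM2l// => xe.
  have e0 : 0 <= e by exact: powR_ge0.
  rewrite leNgt; apply/negP => /(gt0_ltr_powR p0); rewrite !nnegrE.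
  by move=> /(_ e0 (normr_ge0 _)); rewrite ltNge xe.
- rewrite ep; apply: le_trans wsum; rewrite [leRHS](bigID (mem J1))/=.
  apply: ler_wpDl; first by apply: sumr_ge0 => i _; exact: powR_ge0.
  rewrite le_eqVlt; apply/orP; left; apply/eqP; apply: eq_bigl => i.
  by rewrite !inE negb_or.
Qed.

Lemma with_prob_ge_sub (R : realType) (d : measure_display)
    (T : measurableType d) (P : probability T R) (a : R) (E F : set T) :
  E `<=` F -> with_prob_ge P a E -> with_prob_ge P a F.
Proof. by move=> EF [A [mA AE aA]]; exists A; split=> //; exact: subset_trans EF. Qed.

Theorem theorem3 (R : realType) (p q lambda : R) (sigma : nat -> R)
    (p_gt0 : 0 < p) (p_le1 : p <= 1) (p_lt_q : p < q) (q_le2 : q <= 2)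
    (lambda_gt0 : 0 < lambda)
    (sigmaE : forall j : nat, (0 < j)%N -> sigma j = j%:R `^ (- lambda)) :
  exists C D K : R, [/\ 0 < C, 0 < D, 0 < K &
    forall (m n : nat), (1 <= n)%N -> (n < m)%N ->
      D * ln (expR 1 * m%:R / n%:R) <= n%:R ->
    forall (d : measure_display) (T : measurableType d) (P : probability T R)
      (G : 'I_n -> 'I_m -> {RV P >-> R}), gaussian_matrix G ->
      with_prob_ge P (1 - 2 * expR (- C * n%:R))
        [set w : T | (lp_radius q (ellipsoid p sigma m) (rkernel (matrix_at G w))
                      <= (K * (ln (expR 1 * m%:R / n%:R) / n%:R)
                                `^ (lambda + p^-1 - q^-1))%:E)%E]].
Proof.
have [a [b [c [a0 b0 c0 Gbounds]]]] := gaussian_sparse_bounds R.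
have q_gt0 : 0 < q by exact: lt_trans p_lt_q.
set mu := lambda + p^-1 - q^-1.
have mu_gt0 : 0 < mu.
  by rewrite /mu -addrA addr_gt0// subr_gt0 ltf_pV2 ?posrE.
pose B := 3 + (2 * b / a) ^+ 2.
have B0 : 0 < B by rewrite /B; have := sqr_ge0 (2 * b / a); lra.
exists (1 / 100), (2 / c), (B `^ q^-1 * (4 / c) `^ mu); split.
- by lra.
- by rewrite divr_gt0.
- by rewrite mulr_gt0 ?powR_gt0// divr_gt0.
move=> m n n1 nm Dn d T P G GG.
set L := ln _ in Dn *.
have nR : 0 < n%:R :> R by rewrite ltr0n.
have L0 : 0 < L.
  rewrite -(ln1 R) ltr_ln ?posrE ?divr_gt0 ?mulr_gt0 ?expR_gt0 ?ltr0n//; last first.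
    exact: leq_ltn_trans nm.
  rewrite ltr_pdivlMr// mul1r (@lt_le_trans _ _ m%:R) ?ltr_nat//.
  by rewrite ler_peMl// (le_trans _ (expR_ge1Dx _))//; lra.
(* The largest s for which 2s-sparse vectors are under control; D = 2/c ensures
   that it is positive, so that rounding down costs at most a factor 2. *)
pose s := Num.truncn (c * n%:R / (2 * L)).
have L2 : 0 < 2 * L by rewrite mulr_gt0.
have x1 : 1 <= c * n%:R / (2 * L).
  rewrite ler_pdivlMr// mul1r -ler_pdivrMl//; apply: le_trans Dn.
  by rewrite le_eqVlt; apply/orP; left; apply/eqP; field; rewrite gt_eqF.
have s0 : (0 < s)%N by rewrite truncn_gt0.
have sR : 0 < s%:R :> R by rewrite ltr0n.
have s_le : s%:R <= c * n%:R / (2 * L).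
  by rewrite truncn_le (le_trans ler01).
have s_ge : (4 / c * (L / n%:R))^-1 <= s%:R.
  have : c * n%:R / (2 * L) < s.+1%:R by exact: truncnS_gt.
  have : 1 <= s%:R :> R by rewrite ler1n.
  have -> : (4 / c * (L / n%:R))^-1 = c * n%:R / (2 * L) / 2.
    by field; rewrite !gt_eqF.
  by rewrite -(natr1 s); lra.
have -> : - (1 / 100) * n%:R = - (n%:R / 100) :> R by field.
apply: with_prob_ge_sub (Gbounds n m (2 * s)%N d T P G n1 nm _ _ GG) => //; last 2 first.
- by rewrite muln_gt0.
- rewrite -/L natrM -ler_pdivlMr//; apply: (@le_trans _ _ (2 * (c * n%:R / (2 * L)))).
    by rewrite ler_pM2l.
  by rewrite le_eqVlt; apply/orP; left; apply/eqP; field; rewrite gt_eqF.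
move=> w /= Gw; apply: ge_ereal_sup => _ [x [xE xK] <-]; rewrite lee_fin.
have [S] := ellipsoid_flat_tail p_gt0 lambda_gt0 s0 sigmaE xE.
set e := s%:R `^ _ => -[S2 xe xp].
have e0 : 0 < e by exact: powR_gt0.
have an0 : 0 < a * n%:R by exact: mulr_gt0.
have bn0 : 0 <= b * n%:R by rewrite mulr_ge0// ltW.
have := kernel_powR_sum_le s0 an0 bn0 p_gt0 p_le1 p_lt_q q_le2 e0 Gw xK S2 xe xp.
have -> : 2 * (b * n%:R) / (a * n%:R) = 2 * b / a.
  by field; rewrite !gt_eqF.
rewrite -/B => xq.
apply: (@le_trans _ _ ((B * s%:R * e `^ q) `^ q^-1)).
  rewrite ge0_ler_powR ?nnegrE ?invr_ge0 ?(ltW q_gt0)//.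
  - by apply: sumr_ge0 => j _; exact: powR_ge0.
  - by rewrite mulr_ge0 ?powR_ge0// mulr_ge0// ltW.
have eE : (e `^ q) `^ q^-1 = e by rewrite -powRrM mulfV ?gt_eqF// powRr1// ltW.
rewrite powRM ?powR_ge0 ?mulr_ge0 ?(ltW B0)// powRM ?(ltW B0)// eE -!mulrA.
rewrite ler_wpM2l ?powR_ge0// /e -powRD; last by rewrite (gt_eqF sR) implybT.
have -> : q^-1 - (lambda + p^-1) = - mu by rewrite /mu; ring.
have LnR : 0 < L / n%:R by rewrite divr_gt0.
have c4 : 0 < 4 / c by rewrite divr_gt0.
have X0 : 0 < 4 / c * (L / n%:R) by exact: mulr_gt0.
rewrite -powRM ?(ltW c4) ?(ltW LnR)// powRN -[leLHS]mul1r ler_pdivrMr ?powR_gt0//.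
rewrite -powRM ?(ltW X0) ?(ltW sR)//.
apply: (@le_trans _ _ (1 `^ mu)); first by rewrite powR1.
rewrite ge0_ler_powR ?nnegrE ?(ltW mu_gt0) ?(ltW (mulr_gt0 X0 sR))//.
by rewrite -ler_pdivrMl// mulr1.
Qed.
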